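(* Let $k$ be a field and let $G=(V,E)$ be a finite simple graph. Suppose that for every face $F\in\Delta_G$ (including $F=\emptyset$) which is not a facet of $\Delta_G$, the graph $H=G\setminus N_G[F]$ satisfies at least one of the following conditions: (i) $H$ has no chordless even cycle; (ii) $H$ has a simplicial vertex, i.e., for some $z\in V(H)$, the set $N_H[z]$ induces a complete graph; (iii) for some $t\ge 2$, $H$ has a chordless $(2t+1)$-cycle which has $t$ independent vertices of degree $2$ in $H$ (that is, $t$ vertices of the cycle that are pairwise non-adjacent and each of which has degree $2$ in $H$). Then $G$ is sequentially $S_2$ (over $k$).
   Context: For a finite simple graph $G$, $\Delta_G$ is the simplicial complex on the vertex set $V(G)$ whose faces are the independent sets of vertices of $G$; $G$ is called sequentially $S_r$ if $\Delta_G$ is. $N_G(x)$ is the set of neighbors of $x$, $N_G[x]=\{x\}\cup N_G(x)$, and for $F\in\Delta_G$, $N_G(F)=\bigcup_{x\in F}N_G(x)$ and $N_G[F]=F\cup N_G(F)$. $G\setminus U$ is the graph obtained by deleting the vertices in $U$. A finitely generated graded module $M$ over a Noetherian graded $k$-algebra $R$ satisfies Serre's condition $S_r$ if $\operatorname{depth} M_{\mathfrak p}\ge \min(r,\dim M_{\mathfrak p})$ for all $\mathfrak p\in\operatorname{Spec}(R)$. A finitely generated $\mathbb Z$-graded $R$-module $M$ ($R$ a standard graded $k$-algebra) is sequentially $S_r$ if there is a finite filtration $0=M_0\subset M_1\subset\cdots\subset M_t=M$ by graded submodules such that each quotient $M_i/M_{i-1}$ satisfies $S_r$ and $\dim(M_1/M_0)<\dim(M_2/M_1)<\cdots<\dim(M_t/M_{t-1})$.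 A simplicial complex $\Delta$ on $[n]=\{1,\dots,n\}$ is sequentially $S_r$ over $k$ if its face ring $k[\Delta]=k[x_1,\dots,x_n]/I_\Delta$ is sequentially $S_r$ as a module over $R=k[x_1,\dots,x_n]$; here $I_\Delta$ is the Stanley-Reisner ideal, generated by the squarefree monomials $\prod_{j\in F}x_j$ with $F\notin\Delta$. *)

(* Defs.v *)
From HB Require Import structures.
From mathcomp Require Import all_boot all_order all_algebra.
From mathcomp Require Import boolp ring.
From mathcomp Require Import mpoly.

Set Implicit Arguments.
Unset Strict Implicit.
Unset Printing Implicit Defensive.

Import GRing.Theory.
Local Open Scope ring_scope.
Local Open Scope quotient_scope.

Section QuotientModule.
Variables (R : pzRingType) (M : lmodType R).

(* [submodClosed] does not record closure under opposite, which follows here by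
   scaling by -1 and is needed both for subtypes and for quotients. *)
Definition zsub (N : submodClosed M) : {pred M} := fun x => x \in N.

Lemma zsub_closed (N : submodClosed M) : GRing.subsemimod_closed (zsub N).
Proof.
split; first split.
- exact: (@rpred0 _ N).
- by move=> x y; move=> xN yN; exact: (@rpredD _ N x y xN yN).
- by move=> a x; move=> xN; exact: (@rpredZ _ _ N a x xN).
Qed.

HB.instance Definition _ (N : submodClosed M) :=
  GRing.isSubmodClosed.Build R M (zsub N) (zsub_closed N).

Definition submod_type (N : submodClosed M) : Type := {x : M | x \in zsub N}.

HB.instance Definition _ (N : submodClosed M) := SubChoice.on (submod_type N).
HB.instance Definition _ (N : submodClosed M) :=
  [SubChoice_isSubLmodule of submod_type N by <:].

Definition quotmod (N : submodClosed M) : Type := @Quotient.quot M (zsub N).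

HB.instance Definition _ (N : submodClosed M) := Choice.on (quotmod N).
HB.instance Definition _ (N : submodClosed M) := GRing.Zmodule.on (quotmod N).
HB.instance Definition _ (N : submodClosed M) :=
  EqQuotient.on (quotmod N).

Section QuotScale.
Variable N : submodClosed M.

Definition proj (x : M) : quotmod N := \pi_(@Quotient.quot M (zsub N)) x.

Lemma projK (q : quotmod N) : proj (repr q) = q.
Proof. exact: reprK. Qed.

Lemma projP x y : reflect (proj x = proj y) (x - y \in N).
Proof. by rewrite (Quotient.idealrBE (zsub N)); apply: eqP. Qed.

Lemma projD x y : proj (x + y) = proj x + proj y.
Proof. exact: raddfD. Qed.

Definition quot_scale (a : R) (q : quotmod N) : quotmod N :=
  proj (a *: repr q).

Lemma quot_scaleE a x : quot_scale a (proj x) = proj (a *: x).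
Proof. by apply/projP; rewrite -scalerBr rpredZ //; apply/projP/projK. Qed.

Lemma quot_scaleA a b q :
  quot_scale a (quot_scale b q) = quot_scale (a * b) q.
Proof. by rewrite -(projK q) !quot_scaleE scalerA. Qed.

Lemma quot_scale1 : left_id 1 quot_scale.
Proof. by move=> q; rewrite -(projK q) quot_scaleE scale1r. Qed.

Lemma quot_scaleDr : right_distributive quot_scale +%R.
Proof.
move=> a q q'; rewrite -(projK q) -(projK q') -projD !quot_scaleE.
by rewrite scalerDr projD.
Qed.

Lemma quot_scaleDl q : {morph quot_scale^~ q : a b / a + b}.
Proof. by move=> a b; rewrite -(projK q) !quot_scaleE scalerDl projD. Qed.

HB.instance Definition _ := GRing.Zmodule_isLmodule.Build R (quotmod N)
  quot_scaleA quot_scale1 quot_scaleDr quot_scaleDl.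

End QuotScale.

End QuotientModule.

Section SubQuotient.
Variables (R : pzRingType) (M : lmodType R).

(* [N'] seen inside the module [N]; this is [N'] itself when [N'] is contained
   in [N]. *)
Definition submod_in (N' N : submodClosed M) : {pred (submod_type N)} :=
  fun x => val x \in N'.

Lemma submod_in_closed (N' N : submodClosed M) :
  GRing.subsemimod_closed (submod_in N' (N := N)).
Proof.
split; first split.
- exact: (@rpred0 _ N').
- by move=> x y xN yN; exact: (@rpredD _ N' (val x) (val y) xN yN).
- by move=> a x xN; exact: (@rpredZ _ _ N' a (val x) xN).
Qed.

HB.instance Definition _ (N' N : submodClosed M) :=
  GRing.isSubmodClosed.Build R (submod_type N) (@submod_in N' N)
    (submod_in_closed N' N).

(* The quotient module N / N'. *)
Definition subquot (N' N : submodClosed M) : lmodType R :=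
  quotmod (@submod_in N' N : submodClosed (submod_type N)).

End SubQuotient.

Section Localization.
Variables (R : comNzRingType) (p : prime_idealr R).

Definition denom : Type := {s : R | s \notin p}.

HB.instance Definition _ := SubChoice.on denom.

Definition dval (s : denom) : R := val s.

Lemma dvalP (s : denom) : dval s \notin p.
Proof. by case: s. Qed.

Lemma denom_oneP : 1 \notin p.
Proof. by rewrite idealr1. Qed.

Lemma denom_mulP (s t : denom) : dval s * dval t \notin p.
Proof. by rewrite prime_idealrM negb_or (dvalP s) (dvalP t). Qed.

Definition denom1 : denom := Sub 1 denom_oneP.
Definition denomM (s t : denom) : denom := Sub (dval s * dval t) (denom_mulP s t).

Lemma dval1 : dval denom1 = 1. Proof. by []. Qed.
Lemma dvalM s t : dval (denomM s t) = dval s * dval t. Proof. by []. Qed.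

Section Module.
Variable M : lmodType R.

Definition loc_eq : rel (M * denom) := fun x y =>
  `[< exists u : denom,
        dval u *: (dval y.2 *: x.1) = dval u *: (dval x.2 *: y.1) >].

Lemma loc_eq_equiv : equiv_class_of loc_eq.
Proof.
split.
- by move=> x; apply/asboolP; exists denom1.
- by move=> x y; apply/asboolP/asboolP => -[u hu]; exists u.
- move=> y x z /asboolP[u hu] /asboolP[v hv]; apply/asboolP.
  exists (denomM (denomM u v) y.2); rewrite /= !dvalM !scalerA.
  have -> : dval u * dval v * dval y.2 * dval z.2
    = dval v * dval z.2 * (dval u * dval y.2) by ring.
  rewrite -scalerA -(scalerA (dval u)) hu !scalerA.
  have -> : dval v * dval z.2 * dval u * dval x.2
    = dval u * dval x.2 * (dval v * dval z.2) by ring.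
  rewrite -scalerA -(scalerA (dval v)) hv !scalerA; congr (_ *: _); ring.
Qed.

Canonical loc_eq_rel := EquivRelPack loc_eq_equiv.
Canonical loc_eq_enc := defaultEncModRel loc_eq.

Definition locmod : Type := {eq_quot loc_eq}.

HB.instance Definition _ := Choice.on locmod.
HB.instance Definition _ := EqQuotient.on locmod.

Definition frac (m : M) (s : denom) : locmod := \pi_({eq_quot loc_eq}) (m, s).

Lemma fracP m s m' s' :
  frac m s = frac m' s' <->
  exists u : denom, dval u *: (dval s' *: m) = dval u *: (dval s *: m').
Proof.
split=> [/eqmodP/asboolP //|h]; by apply/eqmodP/asboolP.
Qed.

Lemma frac_eq m s m' s' :
  dval s' *: m = dval s *: m' -> frac m s = frac m' s'.
Proof. by move=> h; apply/fracP; exists denom1; rewrite h. Qed.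

Lemma fracW (P : locmod -> Prop) : (forall m s, P (frac m s)) -> forall x, P x.
Proof. by move=> h x; rewrite -[x]reprK; case: (repr x). Qed.

Definition loc_num (x : locmod) : M := (repr x).1.
Definition loc_den (x : locmod) : denom := (repr x).2.

Lemma fracK x : frac (loc_num x) (loc_den x) = x.
Proof. by rewrite /frac -surjective_pairing; exact: reprK. Qed.

Definition loc_zero : locmod := frac 0 denom1.
Definition loc_opp (x : locmod) : locmod := frac (- loc_num x) (loc_den x).
Definition loc_add (x y : locmod) : locmod :=
  frac (dval (loc_den y) *: loc_num x + dval (loc_den x) *: loc_num y)
       (denomM (loc_den x) (loc_den y)).

Lemma loc_oppE m s : loc_opp (frac m s) = frac (- m) s.
Proof.
have /fracP[u hu] := fracK (frac m s).
by apply/fracP; exists u; rewrite !scalerN hu.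
Qed.

Lemma loc_addE m s m' s' :
  loc_add (frac m s) (frac m' s')
  = frac (dval s' *: m + dval s *: m') (denomM s s').
Proof.
have := fracK (frac m s); have := fracK (frac m' s').
rewrite /loc_add; move: (loc_num (frac m s)) (loc_den (frac m s)).
move: (loc_num (frac m' s')) (loc_den (frac m' s')).
move=> n' t' n t /fracP[v hv] /fracP[u hu].
apply/fracP; exists (denomM u v); rewrite /= !dvalM !scalerDr !scalerA.
congr (_ + _).
- have -> : dval u * dval v * (dval s * dval s') * dval t'
    = dval v * dval s' * dval t' * (dval u * dval s) by ring.
  rewrite -scalerA -(scalerA (dval u)) hu !scalerA; congr (_ *: _); ring.
- have -> : dval u * dval v * (dval s * dval s') * dval t
    = dval u * dval s * dval t * (dval v * dval s') by ring.
  rewrite -scalerA -(scalerA (dval v)) hv !scalerA; congr (_ *: _); ring.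
Qed.

Lemma loc_addA : associative loc_add.
Proof.
elim/fracW=> m s; elim/fracW=> n t; elim/fracW=> o u.
rewrite !loc_addE; apply: frac_eq; rewrite /= !dvalM ?dval1.
rewrite !scalerDr !scalerA -!addrA; congr (_ *: _ + (_ *: _ + _ *: _)); ring.
Qed.

Lemma loc_addC : commutative loc_add.
Proof.
elim/fracW=> m s; elim/fracW=> n t; rewrite !loc_addE; apply: frac_eq; rewrite /= !dvalM ?dval1.
rewrite !scalerDr !scalerA addrC; congr (_ *: _ + _ *: _); ring.
Qed.

Lemma loc_add0 : left_id loc_zero loc_add.
Proof.
elim/fracW=> m s; rewrite loc_addE; apply: frac_eq; rewrite /= !dvalM ?dval1.
by rewrite scaler0 add0r scalerA mul1r mulr1.
Qed.

Lemma loc_addN : left_inverse loc_zero loc_opp loc_add.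
Proof.
elim/fracW=> m s; rewrite loc_oppE loc_addE; apply: frac_eq; rewrite /= !dvalM ?dval1.
by rewrite scalerN addNr !scaler0.
Qed.

HB.instance Definition _ :=
  GRing.isZmodule.Build locmod loc_addA loc_addC loc_add0 loc_addN.

End Module.

(* The localized ring: fractions of the regular module. *)
Definition loc : Type := locmod R^o.

HB.instance Definition _ := GRing.Zmodule.on loc.

Definition loc_frac (a : R) (s : denom) : loc := @frac R^o a s.

Lemma locW (P : loc -> Prop) : (forall a s, P (loc_frac a s)) -> forall x, P x.
Proof. by move=> h; apply: fracW => a s; apply: h. Qed.

Lemma loc_frac_eq (a : R) s (b : R) t :
  dval t * a = dval s * b -> loc_frac a s = loc_frac b t.
Proof. by move=> h; apply: frac_eq. Qed.

Lemma loc_fracD (a : R) s (b : R) t :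
  loc_frac a s + loc_frac b t
  = loc_frac (dval t * a + dval s * b) (denomM s t).
Proof. exact: loc_addE. Qed.

Section Scale.
Variable M : lmodType R.

Definition loc_scale (a : loc) (x : locmod M) : locmod M :=
  frac ((loc_num a : R) *: loc_num x) (denomM (loc_den a) (loc_den x)).

Lemma loc_scaleE (a : R) s (m : M) t :
  loc_scale (loc_frac a s) (frac m t) = frac (a *: m) (denomM s t).
Proof.
have := fracK (frac m t); have := fracK (loc_frac a s).
rewrite /loc_scale; move: (loc_num (frac m t)) (loc_den (frac m t)).
move: (loc_num (loc_frac a s)) (loc_den (loc_frac a s)).
move=> b s' n t' /fracP[u /= hu] /fracP[v hv].
apply/fracP; exists (denomM u v); rewrite !dvalM !scalerA.
have -> : dval u * dval v * (dval s * dval t) * (b : R)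
  = (dval u * (dval s * (b : R))) * (dval v * dval t) by ring.
have -> : dval u * (dval s * (b : R)) = dval u * (dval s' * a) by exact: hu.
rewrite -scalerA -(scalerA (dval v)) hv !scalerA; congr (_ *: _); ring.
Qed.

Lemma loc_scale1 : left_id (loc_frac 1 denom1) loc_scale.
Proof.
elim/fracW=> m s; rewrite loc_scaleE; apply: frac_eq; rewrite dvalM dval1.
by rewrite scale1r mul1r.
Qed.

Lemma loc_scaleDr : right_distributive loc_scale +%R.
Proof.
elim/locW=> a r; elim/fracW=> m s; elim/fracW=> n t.
rewrite [_ + _]loc_addE !loc_scaleE [RHS]loc_addE; apply: frac_eq.
rewrite !dvalM !scalerDr !scalerA; congr (_ *: _ + _ *: _); ring.
Qed.

Lemma loc_scaleDl x : {morph loc_scale^~ x : a b / a + b}.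
Proof.
elim/fracW: x=> m t; elim/locW=> a r; elim/locW=> b s.
rewrite loc_fracD !loc_scaleE [RHS]loc_addE; apply: frac_eq.
rewrite !dvalM scalerDl !scalerDr !scalerA; congr (_ *: _ + _ *: _); ring.
Qed.

End Scale.

Definition loc_mul (a b : loc) : loc := loc_scale a b.
Definition loc_one : loc := loc_frac 1 denom1.

Lemma loc_mulE (a : R) s (b : R) t :
  loc_mul (loc_frac a s) (loc_frac b t) = loc_frac (a * b) (denomM s t).
Proof. exact: loc_scaleE. Qed.

Lemma loc_scaleA (M : lmodType R) a b (x : locmod M) :
  loc_scale a (loc_scale b x) = loc_scale (loc_mul a b) x.
Proof.
elim/locW: a=> a r; elim/locW: b=> b s; elim/fracW: x=> m t.
rewrite loc_mulE !loc_scaleE; apply: frac_eq.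
rewrite !dvalM !scalerA; congr (_ *: _); ring.
Qed.

Lemma loc_mulA : associative loc_mul.
Proof. by move=> a b c; rewrite /loc_mul loc_scaleA. Qed.

Lemma loc_mulC : commutative loc_mul.
Proof.
elim/locW=> a r; elim/locW=> b s; rewrite !loc_mulE; apply: loc_frac_eq.
rewrite !dvalM; ring.
Qed.

Lemma loc_mul1 : left_id loc_one loc_mul.
Proof. exact: loc_scale1. Qed.

Lemma loc_mulDl : left_distributive loc_mul +%R.
Proof. by move=> a b x; exact: loc_scaleDl. Qed.

Lemma loc_one_neq0 : loc_one != 0.
Proof.
apply/eqP => /fracP[u]; rewrite /GRing.scale /= !mulr0 !mulr1 => h.
by have := dvalP u; rewrite h idealr0.
Qed.

HB.instance Definition _ := GRing.Zmodule_isComNzRing.Build loc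
  loc_mulA loc_mulC loc_mul1 loc_mulDl loc_one_neq0.

HB.instance Definition _ (M : lmodType R) :=
  GRing.Zmodule_isLmodule.Build loc (locmod M)
    (@loc_scaleA M) (@loc_scale1 M) (@loc_scaleDr M) (@loc_scaleDl M).

(* The maximal ideal pR_p of the local ring R_p. *)
Definition loc_max : {pred loc} := fun x =>
  `[< exists (a : R) (s : denom), a \in p /\ x = loc_frac a s >].

End Localization.

Section DimDepth.
Variables (R : comNzRingType) (M : lmodType R).

(* dim M >= d, where dim M is the Krull dimension of R / Ann M: there is a chain
   q_0 < ... < q_d of primes containing Ann M.  The zero module has no such
   chain, i.e. dimension -oo. *)
Definition dim_ge (d : nat) : Prop :=
  exists q : nat -> prime_idealr R,
    (forall i, (i <= d)%N ->
       forall a : R, (forall m : M, a *: m = 0) -> a \in q i) /\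
    (forall i, (i < d)%N ->
       {subset q i <= q i.+1} /\ ~ {subset q i.+1 <= q i}).

(* m belongs to (s_0, s_1, ...) M; only the values of c below size s matter. *)
Definition in_seqM (s : seq R) (m : M) : Prop :=
  exists c : nat -> M, m = \sum_(i < size s) s`_i *: c i.

(* s is M-regular: s_i is a nonzerodivisor on M / (s_0, ..., s_{i-1}) M for
   every i, and M / (s) M is nonzero. *)
Definition regular_seq (s : seq R) : Prop :=
  (forall i, (i < size s)%N -> forall m : M,
     in_seqM (take i s) (s`_i *: m) -> in_seqM (take i s) m) /\
  (exists m : M, ~ in_seqM s m).

(* depth M >= d, for R local with maximal ideal I. *)
Definition depth_ge (I : {pred R}) (d : nat) : Prop :=
  exists s : seq R, [/\ size s = d, {subset s <= I} & regular_seq s].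

End DimDepth.

(* dim M < dim N, as extended integers. *)
Definition dim_lt (R : comNzRingType) (M N : lmodType R) : Prop :=
  exists d, dim_ge N d /\ ~ dim_ge M d.

(* depth M_p >= min (r, dim M_p) for every prime p; the zero localizations
   (dimension -oo) impose nothing. *)
Definition serre (r : nat) (R : comNzRingType) (M : lmodType R) : Prop :=
  forall (p : prime_idealr R) (d : nat),
    (d <= r)%N -> dim_ge (locmod p M) d ->
    depth_ge (locmod p M) (@loc_max R p) d.

Section Sequentially.
Variables (R : comNzRingType) (M : lmodType R).

(* gr d is the homogeneous component of degree d of M. *)
Variable gr : int -> M -> Prop.

(* A submodule is graded if it is generated by homogeneous elements. *)
Definition graded_submodule (N : submodClosed M) : Prop :=
  forall x, x \in N -> exists s : seq M,
    x = \sum_(y <- s) y /\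
    forall y, y \in s -> y \in N /\ exists d, gr d y.

Definition sequentially_serre (r : nat) : Prop :=
  exists (t : nat) (N : nat -> submodClosed M),
    [/\ N 0%N =i pred1 0 /\ N t =i predT,
        forall i, (i < t)%N ->
          {subset N i <= N i.+1} /\ ~ {subset N i.+1 <= N i},
        forall i, (i <= t)%N -> graded_submodule (N i),
        forall i, (i < t)%N -> serre r (subquot (N i) (N i.+1)) &
        forall i, (i.+1 < t)%N ->
          dim_lt (subquot (N i) (N i.+1)) (subquot (N i.+1) (N i.+2))].

End Sequentially.

Record complex (V : finType) := Complex {
  faces :> {set {set V}};
  faces_set0 : set0 \in faces;
  faces_sub : forall E F : {set V}, E \subset F -> F \in faces -> E \in faces
}.

Definition facet (V : finType) (D : complex V) (F : {set V}) : Prop :=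
  F \in D /\ forall E : {set V}, E \in D -> F \subset E -> E = F.

Section FaceRing.
Variables (k : fieldType) (V : finType) (D : complex V).

(* The variables are indexed by V through its canonical enumeration. *)
Local Notation S := {mpoly k[#|V|]}.

Definition sq_mon (F : {set V}) : S := \prod_(v in F) 'X_(enum_rank v).

(* The ideal generated by the squarefree monomials of the non-faces, as a
   submodule of the regular module. *)
Definition SR_ideal : {pred S^o} := fun f =>
  `[< exists c : {set V} -> S, f = \sum_(F | F \notin faces D) c F * sq_mon F >].

Lemma SR_ideal_closed : GRing.subsemimod_closed SR_ideal.
Proof.
split; first split.
- apply/asboolP; exists (fun=> 0).
  by rewrite big1 // => F _; rewrite mul0r.
- move=> f g /asboolP[c ->] /asboolP[c' ->]; apply/asboolP.
  exists (fun F => c F + c' F); rewrite -big_split /=.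
  by apply: eq_bigr => F _; rewrite mulrDl.
- move=> a f /asboolP[c ->]; apply/asboolP.
  exists (fun F => a * c F); rewrite /GRing.scale /= mulr_sumr.
  by apply: eq_bigr => F _; rewrite mulrA.
Qed.

HB.instance Definition _ :=
  GRing.isSubmodClosed.Build S S^o SR_ideal SR_ideal_closed.

Definition face_ring : lmodType S := quotmod (SR_ideal : submodClosed S^o).

Definition face_ring_grading (d : int) (x : face_ring) : Prop :=
  exists f : S, x = proj (SR_ideal : submodClosed S^o) f /\
    match d with
    | Posz e => f \is e.-homog
    | Negz _ => f = 0
    end.

Definition complex_sequentially_serre (r : nat) : Prop :=
  sequentially_serre face_ring_grading r.

End FaceRing.

Record sgraph := SGraph {
  vertex :> finType;
  edge : rel vertex;
  edge_sym : ssrbool.symmetric edge;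
  edge_irr : irreflexive edge
}.

Section Graph.
Variable G : sgraph.
Implicit Types (x y z : G) (A F U : {set G}).

Definition nbrs x : {set G} := [set y | edge x y].
Definition closed_nbrs x : {set G} := x |: nbrs x.
Definition nbrs_set F : {set G} := \bigcup_(x in F) nbrs x.
Definition closed_nbrs_set F : {set G} := F :|: nbrs_set F.

Definition degree x : nat := #|nbrs x|.

Definition independent A : bool :=
  [forall x in A, forall y in A, ~~ edge x y].

Definition simplicial_vertex z : Prop :=
  forall x y, x \in closed_nbrs z -> y \in closed_nbrs z -> x != y -> edge x y.

(* The list of the vertices of a cycle, in cyclic order, such that the only
   edges between them are those of the cycle. *)
Definition chordless_cycle (c : seq G) : Prop :=
  [/\ (3 <= size c)%N, ucycle (@edge G) c &
      forall x y, x \in c -> y \in c -> edge x y ->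
        y = next c x \/ x = next c y].

Section Delete.
Variable U : {set G}.

Definition delete_edge : rel {x : G | x \notin U} :=
  fun u v => edge (val u) (val v).

Lemma delete_edge_sym : ssrbool.symmetric delete_edge.
Proof. by move=> x y; apply: edge_sym. Qed.

Lemma delete_edge_irr : irreflexive delete_edge.
Proof. by move=> x; apply: edge_irr. Qed.

Definition delete : sgraph := SGraph delete_edge_sym delete_edge_irr.

End Delete.

Definition indep_sets : {set {set G}} := [set A | independent A].

Lemma indep_set0 : set0 \in indep_sets.
Proof. by rewrite inE; apply/forallP => x; rewrite inE. Qed.

Lemma indep_sub A F : A \subset F -> F \in indep_sets -> A \in indep_sets.
Proof.
rewrite !inE => /subsetP sAF /forall_inP hF.
apply/forall_inP => x /sAF /hF /forall_inP hx.
by apply/forall_inP => y /sAF /hx.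
Qed.

Definition indep_complex : complex G := Complex indep_set0 indep_sub.

End Graph.

Definition graph_sequentially_serre (k : fieldType) (G : sgraph) (r : nat) :=
  complex_sequentially_serre k (indep_complex G) r.

Definition no_chordless_even_cycle (H : sgraph) : Prop :=
  forall c : seq H, chordless_cycle c -> odd (size c).

Definition has_simplicial_vertex (H : sgraph) : Prop :=
  exists z : H, simplicial_vertex z.

Definition has_special_odd_cycle (H : sgraph) : Prop :=
  exists (t : nat) (c : seq H) (A : {set H}),
    [/\ (2 <= t)%N, chordless_cycle c, size c = t.*2.+1,
        {subset A <= c} /\ #|A| = t &
        independent A /\ forall x, x \in A -> degree x = 2%N].

(* Main.v *)
(* Let [J_s] be the ideal of the polynomials vanishing on the coordinate subspaces of
   all facets of size at least [s]. With [s] running through the facet sizes, the ideals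
   [J_s] filter the face ring, and a quotient [J_b / J_a] of consecutive steps has the
   facets of size exactly [a] as its minimal primes.

   Its localization at a prime [p] depends on the set [A] of the variables outside [p].
   If [|A| <= a - 2], two polynomials in the other variables are a regular sequence on the ring
   of each facet containing [A]; the first one is also regular on the cokernel of the
   embedding in the product of these rings, because any two facets of size at least [a]
   containing [A] are joined by a chain of such facets with consecutive intersections
   larger than [A]. If [|A| = a - 1], an element of [p] involving only the variables of
   [A] glues without any connectedness. If [|A| = a], the localization is that of a
   polynomial ring, and unique factorization provides the regular sequence.

   The chains come from [H], the graph without [N[A]]. Two disjoint maximal independent
   sets of [H] span a bipartite graph, which has a vertex of degree at most one unless it
   contains a chordless even cycle; exchanging that vertex with its neighbour gives an
   independent set meeting both. A simplicial vertex, or the vertices of degree two on the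
   odd cycle, can be exchanged into every maximal independent set without loss of size. *)

From HB Require Import structures.
From mathcomp Require Import all_boot all_order all_algebra.
From mathcomp Require Import boolp ring zify mpoly.
Require Import Defs.

Set Implicit Arguments.
Unset Strict Implicit.
Unset Printing Implicit Defensive.

Import GRing.Theory.
Local Open Scope ring_scope.

(** * Unique factorization in polynomial rings *)

Definition divides (R : comNzRingType) (a b : R) : Prop := exists c, b = a * c.

Definition prime_elt (R : idomainType) (p : R) : Prop :=
  [/\ p != 0, ~ divides p 1 &
      forall a b, divides p (a * b) -> divides p a \/ divides p b].

Definition prime_product (R : idomainType) (a : R) : Prop :=
  exists (u : R) (s : seq R), [/\ divides u 1, forall p, p \in s -> prime_elt p &
                                  a = u * \prod_(p <- s) p].

(** The factors are prime rather than irreducible, so that uniqueness of the factorization is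
    implicit. *)
Definition factorial (R : idomainType) : Prop :=
  forall a : R, a != 0 -> prime_product a.

Section Divides.
Variable R : comNzRingType.
Implicit Types a b c : R.

Lemma dividesxx a : divides a a. Proof. by exists 1; rewrite mulr1. Qed.

Lemma divides_mulr a b c : divides a b -> divides a (b * c).
Proof. by case=> d ->; exists (d * c); rewrite mulrA. Qed.

Lemma divides_mull a b c : divides a b -> divides a (c * b).
Proof. by rewrite mulrC; apply: divides_mulr. Qed.

Lemma divides_trans b a c : divides a b -> divides b c -> divides a c.
Proof. by move=> ab [d ->]; apply: divides_mulr. Qed.

Lemma dividesD a b c : divides a b -> divides a c -> divides a (b + c).
Proof. by case=> d -> [e ->]; exists (d + e); rewrite mulrDr. Qed.

End Divides.

(** A prime dividing another prime is associate to it, so division by [p] uses up one factor. The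
    shorter list makes the extraction of constant factors terminate. *)
Lemma prime_divides_prod (R : idomainType) (p : R) (s : seq R) u c :
  prime_elt p -> divides u 1 -> (forall q, q \in s -> prime_elt q) ->
  u * \prod_(q <- s) q = p * c ->
  exists u' s', [/\ (size s' < size s)%N, divides u' 1,
    forall q, q \in s' -> prime_elt q & c = u' * \prod_(q <- s') q].
Proof.
case=> p0 pu pP u1; elim: s c => [|q s IH] c sP.
  rewrite big_nil mulr1 => uE; case: pu; apply: divides_trans u1.
  by exists c.
have [q0 qu qP] := sP q (mem_head _ _).
have sP' r : r \in s -> prime_elt r by move=> rs; apply: sP; rewrite inE rs orbT.
rewrite big_cons mulrCA => E.
have /pP [] : divides p (q * (u * \prod_(j <- s) j)) by exists c.
  case=> d qE.
  have /qP [] : divides q (p * d) by exists 1; rewrite mulr1 qE.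
    case=> e pE; exists (u * d), s; split => //.
      case: u1 => v uv; exists (v * e).
      have : q * (e * d) = q * 1 by rewrite mulrA -pE -qE mulr1.
      move/(mulfI q0) => ed; rewrite -[1]mulr1 {1}uv -ed; ring.
    apply: (mulfI p0); rewrite -E {1}qE; ring.
  case=> e dE; case: pu; exists e; apply: (mulfI q0).
  by rewrite mulr1 {1}qE dE; ring.
case=> d dE; have [u' [s' [lts u'1 s'P cE]]] := IH d sP' dE.
exists u', (q :: s'); split => //.
  by move=> r; rewrite inE => /predU1P [->|/s'P //]; split.
by apply: (mulfI p0); rewrite -E dE big_cons cE; ring.
Qed.

(** * Gauss's lemma and factorization in one variable *)

Section PolyFactorial.
Variable R : idomainType.
Hypothesis hR : factorial R.
Implicit Types (f g h : {poly R}) (c : R).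

(** Gauss's lemma. If [p] divides a product, it divides one of the two constant coefficients;
    removing that coefficient and dividing by ['X] lowers the degree of a factor. *)
Lemma prime_elt_polyC (p : R) : prime_elt p -> prime_elt p%:P.
Proof.
case=> p0 pu pP; split; first by rewrite polyC_eq0.
  case=> f /(congr1 (fun g : {poly R} => g`_0)); rewrite coefC coefCM eqxx => E.
  by case: pu; exists f`_0.
have shift f g : divides p%:P (f * 'X + g) -> divides p%:P g -> divides p%:P f.
  case=> h E [k gE]; exists (\poly_(i < size (h - k)) (h - k)`_i.+1).
  apply/polyP => i; rewrite coefCM coef_poly.
  have := congr1 (fun q : {poly R} => q`_i.+1) E.
  rewrite gE /= coefD coefMX /= !coefCM => /(canRL (addrK _)) ->.
  case: ltnP => [_|lt]; first by rewrite coefB mulrBr.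
  by rewrite -mulrBr -coefB nth_default ?mulr0 // leqW.
move=> f; elim/poly_ind: f => [|f c IHf] g; first by left; exists 0; rewrite mulr0.
elim/poly_ind: g => [|g d IHg] H; first by right; exists 0; rewrite mulr0.
have dC (a : R) : divides p a -> divides p%:P a%:P.
  by case=> b ->; exists b%:P; rewrite polyCM.
have /pP [pc|pd] : divides p (c * d).
    case: H => h /(congr1 (fun q : {poly R} => q`_0)).
    rewrite coef0M !coefD !coefMX !coefC coefCM /= !add0r => E.
    by exists h`_0.
- have /IHf [pf|] : divides p%:P (f * (g * 'X + d%:P)).
  + apply: (shift _ (c%:P * (g * 'X + d%:P))); last exact/divides_mulr/dC.
    by have -> : f * (g * 'X + d%:P) * 'X + c%:P * (g * 'X + d%:P)
      = (f * 'X + c%:P) * (g * 'X + d%:P) by ring.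
  + by left; apply: dividesD; [apply: divides_mulr | apply: dC].
  + by right.
- have /IHg [|pg] : divides p%:P ((f * 'X + c%:P) * g).
  + apply: (shift _ (d%:P * (f * 'X + c%:P))); last exact/divides_mulr/dC.
    by have -> : (f * 'X + c%:P) * g * 'X + d%:P * (f * 'X + c%:P)
      = (f * 'X + c%:P) * (g * 'X + d%:P) by ring.
  + by left.
  + by right; apply: dividesD; [apply: divides_mulr | apply: dC].
Qed.

Definition primitive f := forall p, prime_elt p -> ~ divides p%:P f.

(** Each prime factor of [c] divides [f * h] but not [f], hence divides [h] by Gauss's lemma and
    cancels. *)
Lemma primitive_cancel f c g h : primitive f -> c != 0 ->
  c%:P * g = f * h -> divides f g.
Proof.
move=> fP /hR [u [s [[v uv] sP ->]]].
elim: s sP g h => [|p s IH] sP g h.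
  rewrite big_nil mulr1 => E; exists (v%:P * h).
  by rewrite mulrCA -E mulrA -polyCM mulrC -(mulrC u) -uv mulr1.
have pP := sP p (mem_head _ _).
have [p0 _ pI] := prime_elt_polyC pP.
rewrite big_cons mulrCA polyCM -mulrA => E.
have /pI [/fP //|[h' hE]] : divides p%:P (f * h).
  by rewrite -E; exists ((u * \prod_(j <- s) j)%:P * g).
apply: (IH _ _ h'); first by move=> r rs; apply: sP; rewrite inE rs orbT.
by apply: (mulfI p0); rewrite E hE; ring.
Qed.

(** Constant primes are split off one at a time; each uses up a prime factor of the leading
    coefficient. *)
Lemma primitive_part f : f != 0 ->
  exists c g, [/\ c != 0, primitive g & f = c%:P * g].
Proof.
move=> f0; have /hR [u [s [u1 sP sE]]] : lead_coef f != 0 by rewrite lead_coef_eq0.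
have [n] := ubnP (size s); elim: n f f0 u s u1 sP sE => // n IH f f0 u s u1 sP sE ltn.
have [fP|] := pselect (primitive f).
  by exists 1, f; rewrite mul1r oner_eq0; split.
move/existsNP => [p /not_implyP [pP /contrapT [g fE]]].
move: sE; rewrite fE lead_coefM lead_coefC => /esym sE.
have [u' [s' [lts u'1 s'P cE]]] := prime_divides_prod pP u1 sP sE.
have g0 : g != 0 by apply: contra_neq f0 => g0; rewrite fE g0 mulr0.
have [|c [h [c0 hP gE]]] := IH g g0 u' s' u'1 s'P cE.
  by apply: leq_trans lts _; rewrite -ltnS.
exists (p * c), h; split => //; first by rewrite mulf_neq0 //; case: pP.
by rewrite gE polyCM mulrA.
Qed.

Lemma primitive_const f : primitive f -> (size f <= 1)%N -> f != 0 -> divides f 1.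
Proof.
move=> fP /size1_polyC fE; rewrite fE polyC_eq0 => /hR [u [[|p s] [[v uv] sP cE]]].
  by exists v%:P; rewrite cE big_nil mulr1 -polyCM -uv.
case: (fP p); first by apply: sP; rewrite mem_head.
by rewrite fE cE big_cons; exists (u * \prod_(j <- s) j)%:P; rewrite -polyCM mulrCA.
Qed.

Lemma primitive_factor f g h : primitive f -> f = g * h -> primitive g.
Proof. by move=> fP fE p pP pg; apply: (fP p pP); rewrite fE; apply: divides_mulr. Qed.

(** A greatest common divisor up to constants: the primitive part of a nonzero combination of [f]
    and [a] of least degree. Pseudo-division of a combination by it leaves a smaller combination,
    which must be zero. *)
Lemma pseudo_divisor f a : f != 0 -> exists d x y,
  [/\ d != 0, primitive d, divides d f, divides d a &
      exists2 c, c != 0 & c%:P * d = x * f + y * a].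
Proof.
move=> f0.
pose P n := `[< exists x y, x * f + y * a != 0 /\ size (x * f + y * a)%R = n >].
have exP : exists n, P n.
  by exists (size f); apply/asboolP; exists 1, 0; rewrite mul1r mul0r addr0.
case: (ex_minnP exP) => n /asboolP [x [y [d0 dn]]] nmin.
set d := x * f + y * a in d0 dn.
have [c [d' [c0 d'P dE]]] := primitive_part d0.
have d'0 : d' != 0 by apply: contra_neq d0 => E; rewrite dE E mulr0.
have dvd g x' y' : g = x' * f + y' * a -> divides d' g.
  move=> gE; have E := Pdiv.Idomain.divp_eq g d.
  set k := lead_coef d ^+ _ in E.
  have r0 : g %% d = 0.
    apply: contraNeq (d0) => r0; have := ltn_modp g d; rewrite d0 dn ltnNge.
    rewrite nmin //; apply/asboolP.
    exists (k%:P * x' - g %/ d * x), (k%:P * y' - g %/ d * y).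
    have -> : (k%:P * x' - g %/ d * x) * f + (k%:P * y' - g %/ d * y) * a = g %% d.
      by rewrite -[g %% d](addKr (g %/ d * d)) -E -mul_polyC gE /d; ring.
    by [].
  apply: (primitive_cancel (c := k) (h := g %/ d * c%:P) d'P).
    by rewrite expf_neq0 // lead_coef_eq0.
  by rewrite mul_polyC E r0 addr0 {2}dE; ring.
exists d', x, y; split => //.
- by apply: (dvd _ 1 0); rewrite mul1r mul0r addr0.
- by apply: (dvd _ 0 1); rewrite mul1r mul0r add0r.
- by exists c.
Qed.

(** If [f] divides [a * b], let [d] be the common divisor of [f] and [a]. Either its cofactor in [f]
    is a unit and [f] divides [a], or [d] is a unit and the Bezout relation, multiplied by [b],
    shows that [f] divides [b]. *)
Lemma irreducible_prime f : primitive f -> (1 < size f)%N ->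
  (forall g h, f = g * h -> (size g < size f)%N -> ~ (size h < size f)%N) ->
  prime_elt f.
Proof.
move=> fP sf irr; have f0 : f != 0 by rewrite -size_poly_gt0 ltnW.
split => //.
  case=> g E; have g0 : g != 0.
    by apply/eqP => g0; have /eqP := E; rewrite g0 mulr0 oner_eq0.
  have := congr1 (fun q : {poly R} => size q) E; rewrite size_poly1 size_mul // => E'.
  move: sf; rewrite -size_poly_gt0 in g0.
  by case: (size f) E' => [|[|m]] //; case: (size g) g0 => [|l] //; rewrite !addnS.
move=> a b [c E].
have [d [x [y [d0 dP [e fE] da [k k0 kE]]]]] := pseudo_divisor a f0.
have e0 : e != 0 by apply: contra_neq f0 => e0; rewrite fE e0 mulr0.
have szE : size f = (size d + size e).-1 by rewrite fE size_mul.
case: (ltnP (size d) (size f)) => sd; last first.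
  left; apply: (divides_trans (b := d)); last exact: da.
  have : (size e <= 1)%N by lia.
  case/primitive_const => //.
    by apply: (primitive_factor (f := f) (h := d)) => //; rewrite mulrC.
  by move=> v ve; exists v; rewrite fE -mulrA -ve mulr1.
have /negP := irr _ _ fE sd; rewrite -leqNgt => se.
right; have : (size d <= 1)%N.
  by move: se; rewrite szE; case: (size e) => [|m]; rewrite ?addnS ?addn0 /=; lia.
case/(primitive_const dP) => // v dv.
apply: (primitive_cancel (c := k) (h := v * (x * b + y * c))) => //.
have -> : f * (v * (x * b + y * c)) = v * (x * f * b + y * (f * c)) by ring.
rewrite -E; have -> : v * (x * f * b + y * (a * b)) = v * (x * f + y * a) * b by ring.
by rewrite -kE -[LHS]mul1r dv; ring.
Qed.

Lemma poly_factorial : factorial {poly R}.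
Proof.
have cst c : c != 0 -> prime_product c%:P.
  case/hR => u [s [[v uv] sP cE]].
  exists u%:P, [seq polyC p | p <- s]; split.
  - by exists v%:P; rewrite -polyCM -uv.
  - by move=> _ /mapP [q /sP qP ->]; apply: prime_elt_polyC.
  - by rewrite big_map -rmorph_prod -polyCM -cE.
have mulF f g : prime_product f -> prime_product g -> prime_product (f * g).
  case=> u [s [[v uv] sP ->]] [u' [s' [[v' uv'] s'P ->]]].
  exists (u * u'), (s ++ s'); split.
  - by exists (v * v'); rewrite mulrACA -uv -uv' mulr1.
  - by move=> p; rewrite mem_cat => /orP [/sP|/s'P].
  - by rewrite big_cat /= mulrACA.
move=> f; have [n] := ubnP (size f); elim: n f => // n IH f ltn f0.
have [c [g [c0 gP fE]]] := primitive_part f0.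
have g0 : g != 0 by apply: contra_neq f0 => g0; rewrite fE g0 mulr0.
have sgf : size f = size g by rewrite fE mul_polyC size_scale.
rewrite fE; apply: (mulF); first exact: cst.
case: (leqP (size g) 1) => sg.
  exists g, [::]; split => //; first exact: primitive_const.
  by rewrite big_nil mulr1.
have [[a [b [gE sa sb]]]|irr] := pselect (exists a b,
    [/\ g = a * b, (size a < size g)%N & (size b < size g)%N]).
  have sgn : (size g <= n)%N by rewrite -ltnS -sgf.
  rewrite gE; apply: (mulF); apply: IH.
  - exact: leq_trans sa sgn.
  - by apply: contra_neq g0 => a0; rewrite gE a0 mul0r.
  - exact: leq_trans sb sgn.
  - by apply: contra_neq g0 => a0; rewrite gE a0 mulr0.
exists 1, [:: g]; split.
- exact: dividesxx.
- move=> p; rewrite inE => /eqP ->; apply: irreducible_prime => // a b gE sa sb.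
  by apply: irr; exists a, b.
- by rewrite big_seq1 mul1r.
Qed.

End PolyFactorial.

Lemma factorial_iso (R S : idomainType) (f : {rmorphism R -> S})
  (g : {rmorphism S -> R}) : cancel f g -> cancel g f -> factorial R -> factorial S.
Proof.
move=> fK gK hR a a0.
have /hR [u [s [[v uv] sP aE]]] : g a != 0.
  by rewrite -(rmorph0 g) (inj_eq (can_inj gK)).
have dvdK x y : divides (f x) y -> divides x (g y).
  by case=> c ->; exists (g c); rewrite rmorphM fK.
have dvdf x y : divides x (g y) -> divides (f x) y.
  by case=> c E; exists (f c); rewrite -rmorphM -E gK.
exists (f u), [seq f p | p <- s]; split.
- by exists (f v); rewrite -rmorphM -uv rmorph1.
- move=> _ /mapP [p /sP [p0 pu pP] ->]; split.
  + by rewrite -(rmorph0 f) (inj_eq (can_inj fK)).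
  + by move/dvdK; rewrite rmorph1.
  + by move=> x y /dvdK; rewrite rmorphM => /pP [] /dvdf; [left|right].
- by rewrite big_map -rmorph_prod -rmorphM -aE gK.
Qed.

(** * Factorization in several variables *)

Section MpolyFactorial.
Variable k : fieldType.

Section Iso.
Variable n : nat.

(** The inverse of [muni], which regards a polynomial as one in its last variable. *)
Definition mpoly_of_poly (p : {poly {mpoly k[n]}}) : {mpoly k[n.+1]} :=
  (map_poly (@mwiden n k) p).['X_ord_max].

Fact mpoly_of_poly_zmod : zmod_morphism mpoly_of_poly.
Proof. by move=> p q; rewrite /mpoly_of_poly rmorphB hornerD hornerN. Qed.

Fact mpoly_of_poly_monoid : monoid_morphism mpoly_of_poly.
Proof.
split; first by rewrite /mpoly_of_poly rmorph1 hornerC.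
by move=> p q; rewrite /mpoly_of_poly rmorphM hornerM.
Qed.

HB.instance Definition _ :=
  GRing.isZmodMorphism.Build _ _ mpoly_of_poly mpoly_of_poly_zmod.
HB.instance Definition _ :=
  GRing.isMonoidMorphism.Build _ _ mpoly_of_poly mpoly_of_poly_monoid.

Lemma mpoly_morph_ext m (R : nzRingType) (f g : {rmorphism {mpoly k[m]} -> R}) :
  (forall c, f c%:MP = g c%:MP) -> (forall i, f 'X_i = g 'X_i) -> f =1 g.
Proof.
move=> fgC fgX p; rewrite (mpolyE p) !rmorph_sum; apply: eq_bigr => u _.
rewrite -mul_mpolyC !rmorphM fgC; congr (_ * _).
rewrite mpolyXE_id !rmorph_prod; apply: eq_bigr => i _.
by rewrite !rmorphXn fgX.
Qed.

Lemma muni_widen i : muni ('X_(widen_ord (leqnSn n) i) : {mpoly k[n.+1]}) = ('X_i)%:P.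
Proof.
rewrite muniE msuppX big_seq1 mcoeffX eqxx scale1r mnm1E.
have -> : ((widen_ord (leqnSn n)) i == ord_max) = false.
  by apply/negbTE/eqP => /(congr1 val) /= E; have := ltn_ord i; rewrite E ltnn.
rewrite expr0 alg_polyC; congr ('X_[_])%:P.
by apply/mnmP => j; rewrite mnmE !mnm1E -!val_eqE.
Qed.

Lemma muni_max : muni ('X_ord_max : {mpoly k[n.+1]}) = 'X.
Proof.
rewrite muniE msuppX big_seq1 mcoeffX eqxx scale1r mnm1E eqxx expr1.
have -> : [multinom (U_(ord_max : 'I_n.+1)%MM (widen_ord (leqnSn n) i)) | i < n] = 0%MM.
  apply/mnmP => i; rewrite mnmE mnm1E mnm0E.
  by case: eqP => // /(congr1 val) /= E; have := ltn_ord i; rewrite -E ltnn.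
by rewrite mpolyX0 scale1r.
Qed.

Lemma muniK : cancel (@muni n k) mpoly_of_poly.
Proof.
apply: (@mpoly_morph_ext _ _ (mpoly_of_poly \o @muni n k : {rmorphism _ -> _})
  (idfun : {rmorphism _ -> _})) => /= [c|i].
  by rewrite muniC /mpoly_of_poly map_polyC hornerC /= mwidenC.
have [[j ->]|->] : (exists j, i = (widen_ord (leqnSn n)) j) \/ i = ord_max.
  case: (ltnP i n) => ltin; first by left; exists (Ordinal ltin); apply: val_inj.
  by right; apply: val_inj; apply/eqP; rewrite /= eqn_leq ltin andbT -ltnS.
  rewrite muni_widen /mpoly_of_poly map_polyC hornerC /= mwidenX.
  by rewrite mnmwiden1.
by rewrite muni_max /mpoly_of_poly map_polyX hornerX.
Qed.

Lemma mpoly_of_polyK : cancel mpoly_of_poly (@muni n k).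
Proof.
have cK c : muni (mpoly_of_poly c%:P) = c%:P.
  rewrite /mpoly_of_poly map_polyC hornerC /=.
  apply: (@mpoly_morph_ext _ _ (@muni n k \o @mwiden n k : {rmorphism _ -> _})
    (@polyC _ : {rmorphism _ -> _})) => /= [a|i].
    by rewrite mwidenC muniC.
  by rewrite mwidenX mnmwiden1 muni_widen.
elim/poly_ind => [|p c IH]; first by rewrite !rmorph0.
rewrite rmorphD rmorphM rmorphD rmorphM /= IH cK.
by rewrite /mpoly_of_poly map_polyX hornerX muni_max.
Qed.

End Iso.

Lemma mpoly_factorial n : factorial {mpoly k[n]}.
Proof.
elim: n => [|n IH].
  move=> a a0; exists a, [::]; split => //; last by rewrite big_nil mulr1.
  move: a0; rewrite (nvar0_mpolyC a) mpolyC_eq0 => c0.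
  by exists (a@_0%MM)^-1%:MP; rewrite -mpolyCM divff.
exact: (factorial_iso (@mpoly_of_polyK n) (@muniK n) (poly_factorial IH)).
Qed.

End MpolyFactorial.

(** * Restriction of polynomials to coordinate subspaces *)

Lemma morph_congrM (R : comNzRingType) (s : {rmorphism R -> R}) (I : R -> Prop) :
  (forall f g, I f -> I g -> I (f + g)) -> (forall a f, I f -> I (a * f)) ->
  forall f g, I (f - s f) -> I (g - s g) -> I (f * g - s (f * g)).
Proof.
move=> ID IM f g If Ig.
have -> : f * g - s (f * g) = f * (g - s g) + s g * (f - s f) by rewrite rmorphM; ring.
by apply: ID; apply: IM.
Qed.

(** The polynomials congruent to their image form a subring containing the constants and the
    variables. The ideal [I] is a mere predicate, so that prime ideals and [divides e] both fit. *)
Lemma subst_congr (k : fieldType) n (h : 'I_n -> {mpoly k[n]}) (I : {mpoly k[n]} -> Prop) :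
  I 0 -> (forall f g, I f -> I g -> I (f + g)) -> (forall a f, I f -> I (a * f)) ->
  (forall i, I ('X_i - h i)) -> forall f, I (f - mmap (@mpolyC n k) h f).
Proof.
move=> I0 ID IM IX f; pose s : {rmorphism _ -> _} := mmap (@mpolyC n k) h.
rewrite -[mmap _ _ f]/(s f).
have JM := morph_congrM (s := s) ID IM.
have J1 : I (1 - s 1) by rewrite rmorph1 subrr.
have sX i : s 'X_i = h i by rewrite /s /= mmapX mmap1U.
have sC c : s c%:MP = c%:MP by rewrite /s /= mmapC.
move: s sX sC JM J1 => s sX sC JM J1.
elim/mpolyind: f => [|c m f _ _ If]; first by rewrite rmorph0 subr0.
rewrite rmorphD opprD addrACA; apply: (ID); last exact: If.
rewrite -mul_mpolyC; apply: (JM); first by rewrite sC subrr.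
rewrite mpolyXE_id; elim/big_rec: _ => [|i y _ Iy]; first exact: J1.
apply: (JM); last exact: Iy.
elim: (m i) => [|e IHe]; first by rewrite expr0.
by rewrite exprS; apply: (JM); [rewrite sX; apply: IX | apply: IHe].
Qed.

Section Restrict.
Variables (k : fieldType) (n : nat).
Local Notation S := {mpoly k[n]}.
Implicit Types (f g : S) (m : 'X_{1..n}) (A B F : {set 'I_n}) (v w : 'I_n).

Definition mnm_supp m : {set 'I_n} := [set v | m v != 0%N].

Definition set_mnm B : 'X_{1..n} := [multinom (i \in B : nat) | i < n].

Definition sqfree B : S := \prod_(v in B) 'X_v.

(** An endomorphism of the full ring rather than a map to a smaller one, so that restrictions to
    different coordinate subspaces can be compared and composed. *)
Definition restrict F : S -> S :=
  mmap (@mpolyC n k) (fun i => if i \in F then 'X_i else 0).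

HB.instance Definition _ F := GRing.RMorphism.on (restrict F).

Lemma restrictX F m :
  restrict F 'X_[m] = if mnm_supp m \subset F then 'X_[m] else 0.
Proof.
rewrite /restrict mmapX /mmap1; case: ifPn => [mF|/subsetPn [v mv vF]].
  rewrite [RHS]mpolyXE_id; apply: eq_bigr => i _; case: ifPn => // iF.
  suff -> : m i = 0%N by rewrite !expr0.
  apply/eqP; apply: contraNT iF => mi; apply: (subsetP mF).
  by rewrite inE.
rewrite (bigD1 v) //= (negbTE vF) expr0n.
by rewrite inE in mv; rewrite (negbTE mv) mul0r.
Qed.

Lemma restrict_var F v : restrict F 'X_v = if v \in F then 'X_v else 0.
Proof. by rewrite /restrict mmapX mmap1U. Qed.

Lemma restrictC F c : restrict F c%:MP = c%:MP.
Proof. exact: mmapC. Qed.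

Lemma mcoeff_restrict F f m :
  (restrict F f)@_m = if mnm_supp m \subset F then f@_m else 0.
Proof.
rewrite {1}(mpolyE f) rmorph_sum raddf_sum /=.
transitivity (\sum_(i <- msupp f) if mnm_supp m \subset F then (f@_i *: 'X_[i])@_m else 0).
  apply: eq_bigr => i _; rewrite -!mul_mpolyC rmorphM /= restrictC restrictX !mcoeffCM.
  rewrite (fun_if (fun p : S => p@_m)) mcoeff0 !mcoeffX.
  by case: eqP => [->|_]; do 2?case: ifP => _; rewrite ?mulr0.
case: ifP => _; last by rewrite big1_eq.
by rewrite -raddf_sum -mpolyE.
Qed.

Lemma restrict_restrict F F' f : restrict F (restrict F' f) = restrict (F :&: F') f.
Proof.
apply/mpolyP => m; rewrite !mcoeff_restrict subsetI.
by case: (_ \subset F).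
Qed.

Lemma restrict_id F f : restrict F (restrict F f) = restrict F f.
Proof. by rewrite restrict_restrict setIid. Qed.

Lemma restrict_sub A F f : A \subset F -> restrict A (restrict F f) = restrict A f.
Proof. by move=> AF; rewrite restrict_restrict (setIidPl AF). Qed.

Lemma restrict_supr A F f : A \subset F -> restrict F (restrict A f) = restrict A f.
Proof. by move=> AF; rewrite restrict_restrict (setIidPr AF). Qed.

Lemma restrict_eq0 F f :
  restrict F f = 0 <-> forall m, m \in msupp f -> ~~ (mnm_supp m \subset F).
Proof.
split=> [E m mf|H].
  apply/negP => mF; move: mf; rewrite mcoeff_msupp -[f@_m]/(f@_m).
  have := congr1 (mcoeff m) E; rewrite mcoeff_restrict mF mcoeff0 => ->.
  by rewrite eqxx.
apply/mpolyP => m; rewrite mcoeff_restrict mcoeff0; case: ifPn => // mF.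
by apply/eqP; rewrite mcoeff_eq0; apply/negP => /H; rewrite mF.
Qed.

Lemma restrict_eq0S A F f : A \subset F -> restrict F f = 0 -> restrict A f = 0.
Proof. by move=> AF E; rewrite -(restrict_sub f AF) E rmorph0. Qed.

Lemma msize_restrict F f : (msize (restrict F f) <= msize f)%N.
Proof.
rewrite {1}msizeE; apply/bigmax_leqP_seq => m + _.
rewrite mcoeff_msupp mcoeff_restrict; case: ifP => _; last by rewrite eqxx.
by rewrite -mcoeff_msupp; apply: msize_mdeg_lt.
Qed.

Lemma var_neq0 v : 'X_v != 0 :> S.
Proof.
apply: contraTneq isT => /(congr1 (mcoeff U_(v))) /eqP.
by rewrite mcoeffX eqxx mcoeff0 oner_eq0.
Qed.

Lemma sqfree_neq0 B : sqfree B != 0.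
Proof. by apply/prodf_neq0 => v _; apply: var_neq0. Qed.

Lemma restrict_sqfree F B :
  restrict F (sqfree B) = if B \subset F then sqfree B else 0.
Proof.
rewrite /sqfree rmorph_prod /=; case: ifPn => [BF|/subsetPn [v vB vF]].
  by apply: eq_bigr => v /(subsetP BF) vF; rewrite restrict_var vF.
by rewrite (bigD1 v) //= restrict_var (negbTE vF) mul0r.
Qed.

Lemma sqfreeE B : sqfree B = 'X_[set_mnm B].
Proof.
rewrite [RHS]mpolyXE_id /sqfree big_mkcond /=.
by apply: eq_bigr => v _; rewrite mnmE; case: (v \in B).
Qed.

Lemma mnm_supp_leP B m :
  reflect (B \subset mnm_supp m) (set_mnm B <= m)%MM.
Proof.
apply: (iffP mnm_lepP) => [H|H i].
  apply/subsetP => v vB; rewrite inE; have := H v.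
  by rewrite /set_mnm mnmE vB; case: (m v).
rewrite /set_mnm mnmE; case: (boolP (i \in B)) => // /(subsetP H).
by rewrite inE lt0n.
Qed.

Lemma sqfree_divides B f :
  (forall m, m \in msupp f -> B \subset mnm_supp m) -> divides (sqfree B) f.
Proof.
move=> H; rewrite (mpolyE f) big_seq; elim/big_rec: _ => [|m g mf Dg].
  by exists 0; rewrite mulr0.
apply: dividesD => //; rewrite -mul_mpolyC; apply: divides_mull.
have /mnm_supp_leP Bm := H m mf.
by rewrite sqfreeE -(submK Bm) mpolyXD mulrC; exists 'X_[m - set_mnm B].
Qed.

Lemma mnm_supp_mulX B m f : m \in msupp (sqfree B * f) ->
  exists2 m', m' \in msupp f & mnm_supp m = B :|: mnm_supp m'.
Proof.
rewrite sqfreeE mulrC (perm_mem (msuppMX _ _)) => /mapP [m' m'f ->].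
exists m' => //; apply/setP => v; rewrite !inE mnmDE /set_mnm mnmE.
by case: (v \in B); case: (m' v).
Qed.

Lemma divides_restrict v f : restrict (~: [set v]) f = 0 -> divides 'X_v f.
Proof.
move=> /restrict_eq0 H; have -> : 'X_v = sqfree [set v] by rewrite /sqfree big_set1.
apply: sqfree_divides => m /H /subsetPn [w wm]; rewrite !inE negbK => /eqP <-.
by rewrite sub1set.
Qed.

(* The kernel of [restrict A] is the prime ideal generated by the variables
   outside [A]. *)
Lemma sub_restrict_ideal A (p : idealr S) f :
  (forall v, v \notin A -> 'X_v \in p) -> f - restrict A f \in p.
Proof.
move=> H; apply: (subst_congr (I := fun g => g \in p)) => [|f' g|a g|i].
- exact: rpred0.
- exact: rpredD.
- exact: idealMr.
case: ifPn => iA; first by rewrite subrr rpred0.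
by rewrite subr0; apply: H.
Qed.

Lemma restrict_ideal A (p : idealr S) f :
  (forall v, v \notin A -> 'X_v \in p) -> (restrict A f \in p) = (f \in p).
Proof.
move=> H; have D := sub_restrict_ideal f H.
apply/idP/idP => E; first by rewrite -(subrK (restrict A f) f) rpredD.
by have := rpredB E D; rewrite subKr.
Qed.

End Restrict.

(** * Regular elements on coordinate subspaces, and gluing *)

Section RegularSequences.
Variables (k : fieldType) (n : nat).
Local Notation S := {mpoly k[n]}.
Implicit Types (f g h m x y : S) (A B F : {set 'I_n}) (v w : 'I_n).

Definition lin_form A : S := \sum_(v | v \notin A) 'X_v.

(* The exponents are pairwise distinct, so that over any field and on any two
   coordinates this does not vanish identically on the hyperplane [x + y = 0]. *)
Definition pow_form A : S := \sum_(v | v \notin A) 'X_v ^+ v.+1.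

Lemma restrict_lin_form F A :
  restrict F (lin_form A) = \sum_(v in F :\: A) 'X_v.
Proof.
rewrite rmorph_sum /=; under eq_bigr do rewrite restrict_var.
by rewrite -big_mkcondr; apply: eq_bigl => v; rewrite inE andbC.
Qed.

Lemma restrict_pow_form F A :
  restrict F (pow_form A) = \sum_(v in F :\: A) 'X_v ^+ v.+1.
Proof.
rewrite rmorph_sum /=.
transitivity (\sum_(v | (v \notin A) && (v \in F)) ('X_v : S) ^+ v.+1).
  rewrite big_mkcondr; apply: eq_bigr => v _.
  by rewrite rmorphXn /= restrict_var; case: ifP => // _; rewrite expr0n.
by apply: eq_bigl => v; rewrite inE andbC.
Qed.

Lemma restrict_lin_form_neq0 F A : ~~ (F \subset A) -> restrict F (lin_form A) != 0.
Proof.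
case/subsetPn => v vF vA; rewrite restrict_lin_form.
apply: contraTneq isT => /(congr1 (mcoeff U_(v))) /eqP.
rewrite mcoeff0 raddf_sum (bigD1 v) /=; last by rewrite !inE vA.
rewrite mcoeffX eqxx big1 ?addr0 ?oner_eq0 // => w /andP [_ wv].
by rewrite mcoeffX eq_mnm1 (negbTE wv).
Qed.

Lemma lin_form_in A (p : idealr S) : (forall v, v \notin A -> 'X_v \in p) ->
  lin_form A \in p.
Proof. by move=> H; apply: rpred_sum => v /H. Qed.

Lemma pow_form_in A (p : idealr S) : (forall v, v \notin A -> 'X_v \in p) ->
  pow_form A \in p.
Proof. by move=> H; apply: rpred_sum => v /H ?; rewrite exprSr; apply: idealMr. Qed.

(** Modulo the linear form a variable [v] can be eliminated, which leads to a domain; it remains to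
    see that the power form is nonzero there. *)
Lemma pow_form_regular F A f g : (2 <= #|F :\: A|)%N ->
  restrict F (pow_form A) * restrict F f = restrict F (lin_form A) * g ->
  divides (restrict F (lin_form A)) (restrict F f).
Proof.
case/card_gt1P => v [w [vFA wFA vw]]; set e := restrict F (lin_form A) => E.
(* This substitution is congruent to the identity modulo [e] and sends [e] itself to zero. *)
pose h (i : 'I_n) : S := if i == v then 'X_v - e else 'X_i.
pose s : {rmorphism S -> S} := mmap (@mpolyC n k) h.
have sX i : s 'X_i = h i by rewrite /s /= mmapX mmap1U.
have es f' : divides e (f' - s f').
  apply: (subst_congr (I := divides e) (h := h)).
  - by exists 0; rewrite mulr0.
  - exact: dividesD.
  - by move=> a b; apply: divides_mull.
  - move=> i; rewrite /h; case: eqP => [->|_]; last by rewrite subrr; exists 0; rewrite mulr0.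
    by rewrite subKr; apply: dividesxx.
move: s sX es => s sX es.
have sE : s e = 0.
  rewrite /e restrict_lin_form rmorph_sum (bigD1 v) //= sX /h eqxx.
  rewrite (eq_bigr (fun i : 'I_n => 'X_i)); last first.
    by move=> i /andP [_ /negbTE iv]; rewrite sX /h iv.
  by rewrite addrAC -(bigD1 v (F := fun i : 'I_n => 'X_i : S)) //= -restrict_lin_form subrr.
have sy0 : s (restrict F (pow_form A)) != 0.
  apply/eqP => sy; have [q] := es (restrict F (pow_form A)); rewrite sy subr0 => yq.
  (* A line inside the hyperplane [e = 0]: on it the power form becomes a sum of two signed powers
     with different exponents, and so cannot be a multiple of [e]. *)
  pose l (i : 'I_n) : {poly k} := if i == v then - 'X else if i == w then 'X else 0.
  pose r : {rmorphism S -> {poly k}} := mmap (@polyC k) l.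
  have rX i : r 'X_i = l i by rewrite /r /= mmapX mmap1U.
  have wv : (w == v) = false by rewrite eq_sym (negbTE vw).
  have wIn : (w \in F :\: A) && (w != v) by rewrite wFA wv.
  have rest i : (i \in F :\: A) && (i != v) && (i != w) -> l i = 0.
    by case/andP => [/andP [_ /negbTE iv]] /negbTE iw; rewrite /l iv iw.
  have re : r e = 0.
    rewrite /e restrict_lin_form rmorph_sum (bigD1 v) //= (bigD1 w) //= big1.
      by rewrite !rX /l eqxx wv eqxx addr0 addNr.
    by move=> i /rest li; rewrite rX.
  have ry : r (restrict F (pow_form A)) = (- 'X) ^+ v.+1 + 'X ^+ w.+1.
    rewrite restrict_pow_form rmorph_sum (bigD1 v) //= (bigD1 w) //= big1.
      by rewrite !rmorphXn /= !rX /l eqxx wv eqxx addr0.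
    by move=> i /rest li; rewrite rmorphXn /= rX li expr0n.
  have /(congr1 (fun p : {poly k} => p`_v.+1)) : r (restrict F (pow_form A)) = 0.
    by rewrite yq rmorphM re mul0r.
  rewrite ry exprNn -signr_odd mulr_sign coefD coef0 ['X^(w.+1)`_ _]coefXn eqSS.
  have -> : (v == w :> nat) = false by apply/negbTE.
  rewrite addr0; case: ifP => _; rewrite ?coefN coefXn eqxx => /eqP.
    by rewrite oppr_eq0 oner_eq0.
  by rewrite oner_eq0.
have := congr1 s E; rewrite !rmorphM sE mul0r => /eqP.
rewrite mulf_eq0 (negbTE sy0) /= => /eqP sf.
by have := es (restrict F f); rewrite sf subr0.
Qed.

(** Here the linear form is the single variable ['X_v]. As [x] does not involve it, setting it to
    zero shows that it divides [g], and it cancels. *)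
Lemma var_regular F A v f g x : F = v |: A -> v \notin A -> restrict A x = x -> x != 0 ->
  restrict F (lin_form A) * restrict F f = x * g -> divides x (restrict F f).
Proof.
move=> FE vA xA x0.
have -> : restrict F (lin_form A) = 'X_v.
  rewrite restrict_lin_form (big_pred1 v) // => w.
  rewrite FE !inE; case: eqP => [->|_] /=; first by rewrite vA.
  by rewrite andNb.
move=> E; have gv : restrict (~: [set v]) g = 0.
  have := congr1 (restrict (~: [set v])) E; rewrite !rmorphM /= restrict_var !inE eqxx mul0r.
  have -> : restrict (~: [set v]) x = x.
    rewrite -xA restrict_supr //; apply/subsetP => w wA; rewrite !inE.
    by apply: contraNneq vA => <-.
  by move/esym/eqP; rewrite mulf_eq0 (negbTE x0) => /eqP.
have [h gE] := divides_restrict gv.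
by exists h; apply: (mulfI (var_neq0 k v)); rewrite E gE mulrCA.
Qed.

(** A prime factor of a polynomial in the variables of [A] involves only these variables. If [y]
    divides [restrict A h], the quotient satisfies the same equation in smaller degree; in the end
    [y] divides [restrict A y], with a cofactor that is constant by degree and equal to 1 by a
    further restriction. *)
Lemma prime_elt_restrict A y h : prime_elt y -> h != 0 ->
  y * h = restrict A y * restrict A h -> restrict A y = y.
Proof.
move=> yP h0 E; have [y0 yu yI] := yP.
have Ay0 : restrict A y != 0.
  by have := mulf_neq0 y0 h0; rewrite E mulf_eq0 negb_or => /andP [].
have [c cE] : divides y (restrict A y).
  have [l] := ubnP (msize h); elim: l h h0 E => // l IH h h0 E lth.
  have /yI [//|[c cE]] : divides y (restrict A y * restrict A h) by exists h.
  have c0 : c != 0.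
    by have := mulf_neq0 y0 h0; rewrite E cE !mulf_eq0 !negb_or => /and3P [].
  have hE : h = restrict A y * c by apply: (mulfI y0); rewrite E cE mulrCA.
  apply: (IH c) => //.
    by rewrite -cE hE rmorphM /= restrict_id.
  rewrite -ltnS; apply: leq_trans lth; rewrite !ltnS.
  have := msize_restrict A h; rewrite cE msizeM //.
  have : (1 < msize y)%N.
    rewrite ltnNge; apply/negP => /msize1_polyC yC; apply: yu; rewrite yC.
    exists (y@_0%MM)^-1%:MP; rewrite -mpolyCM divff // ?mpolyC1 //.
    by move: y0; rewrite {1}yC mpolyC_eq0.
  case: (msize y) => [|[|a]] // _ le1; apply: leq_trans le1.
  by rewrite addSn /= addSn ltnS leq_addl.
have c0 : c != 0 by apply: contra_neq Ay0 => c0; rewrite cE c0 mulr0.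
have : (msize c <= 1)%N.
  have := msize_restrict A y; rewrite cE msizeM //.
  have : (0 < msize y)%N by rewrite lt0n msize_poly_eq0.
  by case: (msize y) => // a _; rewrite addSn /= -addn1 leq_add2l.
move/msize1_polyC => cC; move: (c@_0%MM) cC => d cC.
have := congr1 (restrict A) cE; rewrite restrict_id rmorphM cC /= restrictC => E'.
have /(mulfI Ay0) d1 : restrict A y * 1 = restrict A y * d%:MP by rewrite mulr1 {1}E'.
by rewrite cE cC -d1 mulr1.
Qed.

(** Some prime factor of [restrict A f] lies in [q], and it involves only the variables of [A]. *)
Lemma prime_elt_in_ideal A (q : prime_idealr S) f :
  (forall v, v \notin A -> 'X_v \in q) -> f \in q -> restrict A f != 0 ->
  exists y, [/\ prime_elt y, y \in q & restrict A y = y].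
Proof.
move=> Aq fq f0; have := f0; move/(@mpoly_factorial k n).
case=> u [s [[c uc] sP fE]].
have uq : u \notin q.
  by apply/negP => uq; have := idealr1 q; rewrite uc mulrC idealMr.
have : restrict A f \in q by rewrite restrict_ideal.
rewrite fE prime_idealrM (negbTE uq) /= => pq.
have [y ys yq] : exists2 y, y \in s & y \in q.
  elim: s {sP fE} pq => [|y s IH]; first by rewrite big_nil idealr1.
  rewrite big_cons prime_idealrM => /orP [yq|/IH [z zs zq]].
    by exists y; rewrite ?mem_head.
  by exists z => //; rewrite inE zs orbT.
exists y; split => //; first exact: sP.
pose h := u * \prod_(z <- rem y s) z.
have fyh : restrict A f = y * h.
  by rewrite fE (perm_big _ (perm_to_rem ys)) big_cons mulrCA.
apply: (@prime_elt_restrict A y h); first exact: sP.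
  by apply: contra_neq f0 => h0; rewrite fyh h0 mulr0.
by rewrite -rmorphM -fyh /= restrict_id.
Qed.

(* [q] lies strictly below the ideal of the variables outside [A], which has height
   one over the ideal of those outside [v |: A]. *)
Lemma height_one A v (q : prime_idealr S) : v \notin A ->
  (forall w, w \notin v |: A -> 'X_w \in q) ->
  (forall f, f \in q -> restrict A f = 0) -> 'X_v \notin q ->
  forall f, f \in q -> restrict (v |: A) f = 0.
Proof.
move=> vA Fq qA vq f; set F := v |: A.
have AF : A \subset F by apply: subsetUr.
have [l] := ubnP (msize (restrict F f)); elim: l f => // l IH f ltl fq.
have [//|g0] := eqVneq (restrict F f) 0.
(* By [qA] the restriction vanishes on ['X_v = 0]; the quotient by ['X_v] is still in the prime [q]
   and has smaller degree. *)
have /divides_restrict [h gE] : restrict (~: [set v]) (restrict F f) = 0.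
  rewrite restrict_restrict; have -> : ~: [set v] :&: F = A.
    apply/setP => w; rewrite !inE; case: eqP => [->|_] //=.
    by rewrite (negbTE vA).
  exact: qA.
have hF : restrict F h = h.
  apply: (mulfI (var_neq0 k v)); rewrite -gE -[RHS]restrict_id gE rmorphM /=.
  by rewrite restrict_var setU11.
have h0 : h != 0 by apply: contra_neq g0 => h0; rewrite gE h0 mulr0.
rewrite gE -hF IH ?mulr0 //.
  rewrite -ltnS; apply: leq_trans ltl; rewrite !ltnS hF gE msizeM ?var_neq0 //.
  by rewrite msizeX mdeg1.
have : restrict F f \in q by rewrite restrict_ideal.
by rewrite gE prime_idealrM (negbTE vq).
Qed.

(* Adding [t F - restrict F f] to a solution [f] on the sets already treated does
   not disturb it, by compatibility. *)
Lemma restrict_glue (s : seq {set 'I_n}) (t : {set 'I_n} -> S) :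
  (forall F, F \in s -> restrict F (t F) = t F) ->
  (forall F F', F \in s -> F' \in s ->
     restrict (F :&: F') (t F) = restrict (F :&: F') (t F')) ->
  exists f, forall F, F \in s -> restrict F f = t F.
Proof.
elim: s => [|F0 s IH] tF tc; first by exists 0.
have sub F : F \in s -> F \in F0 :: s by rewrite inE orbC => ->.
have [|F F' Fs F's|f fE] := IH; [by move=> F /sub /tF|by apply: tc; apply: sub|].
exists (f + (t F0 - restrict F0 f)) => F; rewrite inE => /predU1P [->|Fs].
  by rewrite rmorphD rmorphB /= restrict_id tF ?mem_head // addrC subrK.
rewrite rmorphD rmorphB /= (fE F Fs) restrict_restrict.
suff -> : restrict F (t F0) = restrict (F :&: F0) f by rewrite subrr addr0.
rewrite -(tF F0) ?mem_head // restrict_restrict -(tc F F0) ?mem_head ?sub //.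
by rewrite -(fE F Fs) restrict_sub // subsetIl.
Qed.

End RegularSequences.

(** * Regular sequences over localizations *)

Section Localize.
Variables (R : comNzRingType) (p : prime_idealr R).

Definition loc_int (a : R) : loc p := loc_frac a (denom1 p).

Lemma loc_int0 : loc_int 0 = 0.
Proof. by []. Qed.

Lemma loc_int1 : loc_int 1 = 1.
Proof. by []. Qed.

Lemma loc_intD a b : loc_int (a + b) = loc_int a + loc_int b.
Proof.
by rewrite [RHS]loc_fracD; apply: loc_frac_eq; rewrite !dvalM !dval1 !mul1r.
Qed.

Lemma loc_intM a b : loc_int (a * b) = loc_int a * loc_int b.
Proof.
by rewrite [RHS]loc_mulE; apply: loc_frac_eq; rewrite !dvalM !dval1 !mul1r.
Qed.

Lemma loc_intE a s : loc_int a = loc_int (dval s) * loc_frac a s.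
Proof.
by rewrite [RHS]loc_mulE; apply: loc_frac_eq; rewrite !dvalM !dval1 !mul1r.
Qed.

Lemma loc_fracE a s : loc_frac a s = loc_frac 1 s * loc_int a.
Proof.
by rewrite [RHS]loc_mulE; apply: loc_frac_eq; rewrite !dvalM !dval1 !mul1r mulr1.
Qed.

Section Contract.
Variable q : prime_idealr (loc p).

Definition contract : {pred R} := fun a => loc_int a \in q.

Lemma contract_closed : idealr_closed contract.
Proof.
split.
- by rewrite -topredE /= /contract loc_int0 idealr0.
- by rewrite -topredE /= /contract loc_int1 idealr1.
- move=> a x y; rewrite -!topredE /= /contract => xq yq.
  by rewrite loc_intD loc_intM rpredD // idealMr.
Qed.

Lemma contract_prime : prime_idealr_closed contract.
Proof.
by move=> a b; rewrite -!topredE /= /contract loc_intM prime_idealrM.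
Qed.

HB.instance Definition _ := isIdealr.Build R contract contract_closed.
HB.instance Definition _ := isPrimeIdealrClosed.Build R contract contract_prime.

Lemma contract_sub : {subset contract <= p}.
Proof.
move=> a; rewrite -topredE /= /contract => aq; apply: contraT => ap.
suff : (1 : loc p) \in q by rewrite idealr1.
have -> : 1 = loc_frac 1 (Sub a ap : denom p) * loc_int a.
  rewrite [RHS]loc_mulE; apply: loc_frac_eq.
  by rewrite dvalM !dval1 !mulr1 !mul1r.
exact: idealMr.
Qed.

End Contract.

Lemma loc_frac_contract (q : prime_idealr (loc p)) a s :
  loc_frac a s \in q -> a \in contract q.
Proof. by rewrite -topredE /= /contract (loc_intE a s); apply: idealMr. Qed.

Lemma contract_loc_frac (q : prime_idealr (loc p)) a s :
  a \in contract q -> loc_frac a s \in q.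
Proof. by rewrite -topredE /= /contract => aq; rewrite loc_fracE idealMr. Qed.

Variable M : lmodType R.
Local Notation Mp := (locmod p M).

Lemma frac_eq0 (m : M) s :
  @frac R p M m s = 0 <-> exists u : denom p, dval u *: m = 0.
Proof.
have -> : (0 : Mp) = frac 0 (denom1 p) by [].
rewrite fracP dval1; split=> -[u uE]; exists u.
  by rewrite !scaler0 scale1r in uE.
by rewrite !scaler0 scale1r.
Qed.

Lemma loc_int_scale a (m : M) s : loc_int a *: @frac R p M m s = frac (a *: m) s.
Proof.
rewrite [LHS]loc_scaleE; apply: frac_eq.
by rewrite !dvalM dval1 mul1r.
Qed.

Lemma frac_scale1 (m : M) (u s : denom p) : frac (dval u *: m) (denomM u s) = frac m s.
Proof. by apply: frac_eq; rewrite !dvalM scalerA mulrC. Qed.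

Lemma frac0 s : @frac R p M 0 s = 0.
Proof. by apply/frac_eq0; exists (denom1 p); rewrite scaler0. Qed.

(** Primes of the localization contract to primes inside [p]; strictness of inclusions survives
    because a fraction belongs to a prime exactly when its numerator belongs to the contraction. *)
Lemma dim_ge_loc d : dim_ge Mp d ->
  exists Q : nat -> prime_idealr R,
    [/\ forall i, {subset Q i <= p},
        forall a, (forall m : M, a *: m = 0) -> a \in Q 0%N &
        forall i, (i < d)%N ->
          {subset Q i <= Q i.+1} /\ exists2 a, a \in Q i.+1 & a \notin Q i].
Proof.
case=> q [qann qchain].
exists (fun i => contract (q i) : prime_idealr R); split.
- by move=> i; apply: contract_sub.
- move=> a aM; apply: qann => //; elim/fracW => m s.
  by rewrite loc_int_scale aM frac0.
- move=> i /qchain [qS qN]; split; first by move=> a; rewrite -!topredE; apply: qS.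
  apply: contrapT => H; apply: qN; elim/locW => a s aq.
  apply: contract_loc_frac; apply: contrapT => /negP aN; apply: H.
  by exists a => //; apply: loc_frac_contract aq.
Qed.

Lemma loc_int_max a : a \in p -> loc_int a \in @loc_max R p.
Proof. by move=> ap; apply/asboolP; exists a, (denom1 p). Qed.

Lemma in_seqM0 (N : lmodType (loc p)) (m : N) : in_seqM [::] m <-> m = 0.
Proof.
split=> [[c ->]|->]; first by rewrite big_ord0.
by exists (fun=> 0); rewrite big_ord0.
Qed.

Lemma in_seqM1 (N : lmodType (loc p)) a (m : N) :
  in_seqM [:: a] m <-> exists c, m = a *: c.
Proof.
split=> [[c ->]|[c ->]]; first by exists (c 0%N); rewrite big_ord1.
by exists (fun=> c); rewrite big_ord1.
Qed.

(* Nakayama's lemma in the form of an explicit proper submodule [Y]. *)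
Lemma loc_seq_proper (Y : M -> Prop) (s : seq R) :
  (forall m m', Y m -> Y m' -> Y (m + m')) -> (forall a m, Y m -> Y (a *: m)) ->
  (forall a m, a \in p -> Y (a *: m)) ->
  (forall a m, a \notin p -> Y (a *: m) -> Y m) ->
  (exists m, ~ Y m) -> {subset s <= p} ->
  exists m : Mp, ~ in_seqM (map loc_int s) m.
Proof.
move=> YD YZ YM YU [m0 Ym0] sp; exists (frac m0 (denom1 p)) => -[c E].
(* Elements of the submodule generated by the sequence are fractions with numerator in [Y]; clearing
   denominators then forces [m0] into [Y]. *)
suff [m [t [Ym mE]]] : exists m t, Y m /\ frac m0 (denom1 p) = @frac R p M m t.
  case/fracP: mE => u; rewrite dval1 scale1r scalerA => uE.
  by apply: Ym0; apply: (YU _ _ (denom_mulP u t)); rewrite uE; apply: YZ.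
rewrite E; elim/big_rec: _ => [|i z _ [m [t [Ym ->]]]].
  exists 0, (denom1 p); split=> //; rewrite -(scale0r m0); apply: YM.
  exact: idealr0.
have lti : (i < size s)%N by rewrite -[X in (_ < X)%N](size_map loc_int); apply: ltn_ord.
have sip : s`_i \in p by apply/sp/mem_nth.
elim/fracW: (c i) => m' t'.
rewrite (nth_map 0) // loc_int_scale [_ + _]loc_addE.
exists (dval t *: (s`_i *: m') + dval t' *: m), (denomM t' t); split => //.
by apply: YD; apply: YZ => //; apply: YM.
Qed.

(** Regularity on the localization at [p] with denominators cleared; the next definition does the
    same for [y] modulo [x]. *)
Definition loc_regular (x : R) := forall m : M, x *: m = 0 -> exists2 u, u \notin p & u *: m = 0.

Definition loc_regular2 (x y : R) := forall m m' : M, y *: m = x *: m' ->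
  exists u m'', u \notin p /\ u *: m = x *: m''.

Lemma loc_regular_frac x (z : Mp) : loc_regular x -> loc_int x *: z = 0 -> z = 0.
Proof.
move=> xP; elim/fracW: z => m s; rewrite loc_int_scale => /frac_eq0 [u].
rewrite scalerA mulrC -scalerA => /xP [v vp]; rewrite scalerA => E.
by apply/frac_eq0; exists (denomM (Sub v vp) u).
Qed.

Lemma depth_ge_loc0 :
  (exists m : Mp, ~ in_seqM (map loc_int [::]) m) -> depth_ge Mp (@loc_max R p) 0.
Proof. by move=> N; exists [::]; split. Qed.

Lemma depth_ge_loc1 x : x \in p -> loc_regular x ->
  (exists m : Mp, ~ in_seqM (map loc_int [:: x]) m) -> depth_ge Mp (@loc_max R p) 1.
Proof.
move=> xp xP N; exists [:: loc_int x]; split => //.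
  by move=> y; rewrite inE => /eqP ->; apply: loc_int_max.
split=> // -[|//] _ m /=; rewrite !in_seqM0; exact: loc_regular_frac.
Qed.

Lemma depth_ge_loc2 x y : x \in p -> y \in p -> loc_regular x -> loc_regular2 x y ->
  (exists m : Mp, ~ in_seqM (map loc_int [:: x; y]) m) -> depth_ge Mp (@loc_max R p) 2.
Proof.
move=> xp yp xP yP N; exists [:: loc_int x; loc_int y]; split => //.
  by move=> z; rewrite !inE => /orP [] /eqP ->; apply: loc_int_max.
split=> // -[|[|//]] _ z /=; first by rewrite !in_seqM0; apply: loc_regular_frac.
rewrite !in_seqM1 => -[c]; elim/fracW: z => m t; elim/fracW: c => m' t'.
rewrite !loc_int_scale => /fracP [u E].
have /yP [v [m'' [vp E']]] : y *: (dval u *: (dval t' *: m)) = x *: (dval u *: (dval t *: m')).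
  by move: E; rewrite !scalerA -!(mulrC y) -!(mulrC x) !mulrA.
exists (frac m'' (denomM (denomM (denomM (Sub v vp) u) t') t)).
rewrite loc_int_scale -E' -(frac_scale1 m (denomM (denomM (Sub v vp) u) t') t).
by rewrite !dvalM !scalerA [dval (Sub v vp)]SubK mulrA.
Qed.

End Localize.

(** * Dimension of coordinate subspaces *)

Lemma row_dependency (k : fieldType) (I J : finType) (A : I -> J -> k) :
  (#|J| < #|I|)%N ->
  exists c : I -> k, (exists i, c i != 0) /\ forall j, \sum_i c i * A i j = 0.
Proof.
move=> lt; pose X : 'M[k]_(#|I|, #|J|) := \matrix_(i, j) A (enum_val i) (enum_val j).
have : kermx X != 0.
  rewrite -mxrank_eq0 mxrank_ker subn_eq0 -ltnNge.
  exact: leq_ltn_trans (rank_leq_col X) lt.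
case/rowV0Pn => u /sub_kermxP uX u0.
exists (fun i => u 0 (enum_rank i)); split.
  have [j uj] := rV0Pn _ u0; exists (enum_val j); by rewrite enum_valK.
move=> j; have := congr1 (fun Y : 'rV_ _ => Y 0 (enum_rank j)) uX.
rewrite !mxE => E; rewrite -[RHS]E [RHS](reindex enum_rank) /=; last exact/onW_bij/enum_rank_bij.
by apply: eq_bigr => i _; rewrite mxE !enum_rankK.
Qed.

Section Dependence.
Variables (k : fieldType) (n : nat) (F : {set 'I_n}).
Local Notation S := {mpoly k[n]}.

Definition bounded (e : nat) (f : S) :=
  forall m, m \in msupp f -> mnm_supp m \subset F /\ (mdeg m <= e)%N.

Lemma bounded1 : bounded 0 1.
Proof.
move=> m; rewrite msupp1 inE => /eqP ->; rewrite mdeg0; split=> //.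
by apply/subsetP => v; rewrite inE mnm0E.
Qed.

Lemma boundedM e e' f g : bounded e f -> bounded e' g -> bounded (e + e') (f * g).
Proof.
move=> fe ge m /msuppM_le /allpairsP [[m1 m2] /= [/fe [F1 d1] /ge [F2 d2] ->]].
split; last by rewrite mdegD leq_add.
apply/subsetP => v; rewrite inE mnmDE addn_eq0 negb_and => /orP [] vm.
  by apply: (subsetP F1); rewrite inE.
by apply: (subsetP F2); rewrite inE.
Qed.

Lemma bounded_restrict f : bounded (msize f) (restrict F f).
Proof.
move=> m; rewrite mcoeff_msupp mcoeff_restrict; case: ifP => [mF|]; last by rewrite eqxx.
by rewrite -mcoeff_msupp => /msize_mdeg_lt /ltnW.
Qed.

(** A count: the monomials in the [z i] with exponents below a large [K] outnumber the monomials in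
    the variables of [F] that can occur in them, so they are linearly dependent. *)
Lemma algebraic_dependence N (z : 'I_N -> S) : (#|F| < N)%N ->
  (forall i, restrict F (z i) = z i) ->
  exists2 P : {mpoly k[N]}, P != 0 & mmap (@mpolyC n k) z P = 0.
Proof.
move=> ltFN zF; pose D := \max_(i < N) msize (z i).
have zD i : bounded D (z i).
  move=> m; rewrite -(zF i) => /bounded_restrict [mF dm]; split => //.
  by apply: leq_trans dm _; apply: (leq_bigmax i).
(* The products have degree below [C * K], so they lie in a space spanned by [(C * K) ^ a]
   monomials. Since [K] exceeds [C ^ a], this is less than [K ^ a.+1], hence less than [K ^ N]. *)
pose a := #|F|; pose C := (N * D).+1; pose K := (C ^ a).+1.
pose I := {ffun 'I_N -> 'I_K}; pose J := {ffun 'I_a -> 'I_(C * K)}.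
pose mI (phi : I) : 'X_{1..N} := [multinom phi i : nat | i < N].
pose mJ (psi : J) : 'X_{1..n} := [multinom
  (if insub (index i (enum F)) is Some j then psi j : nat else 0%N) | i < n].
have cardIJ : (#|J| < #|I|)%N.
  rewrite !card_ffun !card_ord; apply: (@leq_trans (K ^ a.+1)).
    by rewrite expnMn expnS ltn_mul2r expn_gt0 ltnSn.
  by rewrite leq_exp2l // ltnS expn_gt0.
pose w (phi : I) : S := mmap1 z (mI phi).
have wb phi : bounded (C * K).-1 (w phi).
  have H : bounded (\sum_(i < N) phi i * D) (w phi).
    rewrite /w /mmap1; apply: (big_ind2 bounded) => [|e f e' g|i _].
    - exact: bounded1.
    - exact: boundedM.
    rewrite mnmE; elim: (phi i : nat) => [|e IH]; first exact: bounded1.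
    by rewrite exprS mulSn; apply: boundedM.
  move=> m /H [mF dm]; split => //; apply: leq_trans dm _.
  apply: (@leq_trans (N * (K * D))).
    rewrite -[X in (_ <= X * _)%N](card_ord N) -sum_nat_const; apply: leq_sum => i _.
    by rewrite leq_mul2r ltnW ?orbT.
  by rewrite /C mulSn mulnCA mulnC /K addSn /= leq_addl.
have [c [[phi0 c0] cE]] := row_dependency (fun (phi : I) (psi : J) => (w phi)@_(mJ psi)) cardIJ.
have mI_inj : injective mI.
  move=> phi phi' /mnmP E; apply/ffunP => i; apply: val_inj.
  by have := E i; rewrite !mnmE.
exists (\sum_phi c phi *: 'X_[mI phi]).
  apply: contraNneq c0 => /(congr1 (mcoeff (mI phi0))).
  rewrite mcoeff0 raddf_sum (bigD1 phi0) //= mcoeffZ mcoeffX eqxx mulr1 big1 ?addr0 => [->//|].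
  move=> phi ne; rewrite mcoeffZ mcoeffX (inj_eq mI_inj) (negbTE ne) mulr0 //.
rewrite rmorph_sum /=; apply/mpolyP => m; rewrite mcoeff0 raddf_sum /=.
have E phi : (mmap (@mpolyC n k) z (c phi *: 'X_[mI phi]))@_m = c phi * (w phi)@_m.
  by rewrite mmapZ mmapX mul_mpolyC mcoeffZ.
under eq_bigr do rewrite E.
have [[psi ->]|H] := pselect (exists psi, m = mJ psi); first exact: cE.
apply: big1 => phi _; suff -> : (w phi)@_m = 0 by rewrite mulr0.
apply: memN_msupp_eq0; apply/negP => /wb [mF dm]; apply: H.
have ltm i : (m i < C * K)%N.
  apply: (@leq_ltn_trans (C * K).-1); last by rewrite ltn_predL muln_gt0.
  by apply: leq_trans dm; rewrite mdegE (bigD1 i) //= leq_addr.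
exists [ffun j => Ordinal (ltm (enum_val j))].
apply/mnmP => i; rewrite mnmE; case: insubP => [j _ jE|].
  have iF : i \in enum F by rewrite -index_mem -jE -cardE; apply: (ltn_ord j).
  by rewrite ffunE /= (enum_val_nth i) [nat_of_ord j]jE nth_index.
rewrite /a cardE index_mem mem_enum => iF; apply/eqP; apply: contraNT iF => mi.
by apply: (subsetP mF); rewrite inE.
Qed.

End Dependence.

(** * Chains of primes and coordinate primes *)

Section Chains.
Variables (k : fieldType) (n : nat).
Local Notation S := {mpoly k[n]}.

Lemma mmap_muni N (z : 'I_N.+1 -> S) (P : {mpoly k[N.+1]}) :
  mmap (@mpolyC n k) z P =
  (map_poly (mmap (@mpolyC n k) (fun i => z (widen_ord (leqnSn N) i))) (muni P)).[z ord_max].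
Proof.
pose e : {rmorphism {mpoly k[N]} -> S} :=
  mmap (@mpolyC n k) (fun i => z (widen_ord (leqnSn N) i)).
pose r : {rmorphism {mpoly k[N.+1]} -> S} := horner_eval (z ord_max) \o map_poly e \o @muni N k.
apply: (mpoly_morph_ext (f := mmap (@mpolyC n k) z) (g := r)) => [c|i].
  by rewrite /r /= mmapC muniC map_polyC /horner_eval hornerC /= mmapC.
rewrite /= mmapX mmap1U /horner_eval.
have [[j ->]|->] : (exists j, i = widen_ord (leqnSn N) j) \/ i = ord_max.
  case: (ltnP i N) => ltin; first by left; exists (Ordinal ltin); apply: val_inj.
  by right; apply: val_inj; apply/eqP; rewrite /= eqn_leq ltin andbT -ltnS.
  by rewrite muni_widen map_polyC hornerC /= mmapX mmap1U.
by rewrite muni_max map_polyX hornerX.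
Qed.

(* The lowest power of [x 0] can be cancelled modulo [q 0]; what remains is, modulo
   [q 1], a nonzero polynomial in the other elements. *)
Lemma prime_chain_independent N (P : {mpoly k[N]}) (q : nat -> prime_idealr S) (x : nat -> S) :
  P != 0 -> (forall j, (j < N)%N -> {subset q j <= q j.+1}) ->
  (forall j, (j < N)%N -> x j \in q j.+1 /\ x j \notin q j) ->
  mmap (@mpolyC n k) (fun i : 'I_N => x (N - i.+1)%N) P \notin q 0%N.
Proof.
elim: N P q x => [|N IH] P q x P0 qS qx.
  move: P0; rewrite (nvar0_mpolyC P) mmapC mpolyC_eq0 => c0.
  apply/negP => /(idealMr (P@_0%MM)^-1%:MP).
  by rewrite -mpolyCM mulVf // mpolyC1 idealr1.
(* The indices run backwards so that the last variable, which [muni] isolates, takes the value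
   [x 0]. *)
rewrite mmap_muni /= subnn; set r := mmap _ _.
have rq c : c != 0 -> r c \notin q 1%N.
  move=> c0; rewrite /r.
  have -> : mmap (@mpolyC n k) (fun i => x (N.+1 - i.+1)%N) c
          = mmap (@mpolyC n k) (fun i : 'I_N => x (N - i.+1).+1) c.
    by apply: eq_bigr => m _; congr (_ * _); apply: eq_bigr => i _; rewrite subSn.
  apply: (IH c (fun j => q j.+1) (fun j => x j.+1)) => // j ltj; first exact: qS.
  exact: qx.
have : muni P != 0 by apply: contra_neq P0 => E; rewrite -(muniK P) E rmorph0.
have [x1 x0] := qx 0%N isT.
elim/poly_ind: (muni P) => [|T c IHT]; first by rewrite eqxx.
rewrite rmorphD rmorphM /= map_polyX map_polyC hornerMXaddC => T0.
have [c0|c0] := eqVneq c 0.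
  rewrite c0 raddf0 addr0 prime_idealrM negb_or x0 andbT; apply: IHT.
  by apply: contra_neq T0 => T0; rewrite T0 c0 mul0r addr0.
apply: contra (rq c c0) => /qS - /(_ isT) H.
by rewrite -(rpredDl _ (idealMr ((map_poly r T).[x 0%N]) x1)).
Qed.

Definition vars_ideal (B : {set 'I_n}) : {pred S} := fun f => restrict B f == 0.

Lemma vars_ideal_closed B : idealr_closed (vars_ideal B).
Proof.
split; rewrite -?topredE /= /vars_ideal ?rmorph0 ?rmorph1 ?oner_eq0 //.
move=> a x y; rewrite -!topredE /= /vars_ideal => /eqP x0 /eqP y0.
by rewrite rmorphD rmorphM /= x0 y0 mulr0 addr0.
Qed.

Lemma vars_ideal_prime B : prime_idealr_closed (vars_ideal B).
Proof.
by move=> x y; rewrite -!topredE /= /vars_ideal rmorphM mulf_eq0.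
Qed.

HB.instance Definition _ B := isIdealr.Build S (vars_ideal B) (vars_ideal_closed B).
HB.instance Definition _ B :=
  isPrimeIdealrClosed.Build S (vars_ideal B) (@vars_ideal_prime B).

Lemma vars_idealE B f : (f \in vars_ideal B) = (restrict B f == 0).
Proof. by []. Qed.

(** Pick an element in each prime outside the preceding one. For a longer chain, their restrictions
    to [F] would satisfy a polynomial relation, which the chain excludes. *)
Lemma prime_chain_length (F : {set 'I_n}) d (q : nat -> prime_idealr S) :
  (forall v, v \notin F -> 'X_v \in q 0%N) ->
  (forall i, (i < d)%N -> {subset q i <= q i.+1} /\ ~ {subset q i.+1 <= q i}) ->
  (d <= #|F|)%N.
Proof.
move=> Fq chain; rewrite leqNgt; apply/negP => ltFd.
have ex j : exists x, (j < d)%N -> x \in q j.+1 /\ x \notin q j.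
  case: (ltnP j d) => [/chain [_ H]|]; last by exists 0.
  apply: contrapT => N; apply: H => x xq; apply: contrapT => /negP xN.
  by apply: N; exists x.
have [x xP] := choice ex.
have Fqj v j : v \notin F -> (j <= d)%N -> 'X_v \in q j.
  move=> /Fq vq; elim: j => // j IHj ltj; have [sub _] := chain j ltj.
  by apply: sub; apply: IHj; apply: ltnW.
pose z (i : 'I_d) := restrict F (x (d - i.+1)%N).
have [|P P0 PE] := algebraic_dependence ltFd (z := z).
  by move=> i; rewrite /z restrict_id.
have := @prime_chain_independent d P q (restrict F \o x) P0.
rewrite [mmap _ _ _]PE idealr0 => H; suff : ~~ true by []; apply: H; first by move=> j /chain [].
move=> j ltj; have [x1 x0] := xP j ltj.
by rewrite /= !restrict_ideal // => v vF; apply: Fqj => //; apply: ltnW.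
Qed.

End Chains.

(** * Depth of the strata *)

Section Stratum.
Variables (k : fieldType) (n : nat).
Local Notation S := {mpoly k[n]}.
Implicit Types (f g h x y : S) (A B F : {set 'I_n}) (v w : 'I_n).

(* [L] collects the facets of size at least [a]; the module [M] consists of the
   functions vanishing on the facets of size more than [a], modulo those vanishing
   on all of [L]. *)
Variables (L : {set {set 'I_n}}) (a : nat).
Hypothesis L_anti : forall F F', F \in L -> F' \in L -> F \subset F' -> F = F'.
(** Connectedness by chains of facets with intersections larger than [A], expressed through
    functions [g] that are constant along each step. *)
Hypothesis L_conn : forall A, (#|A| + 2 <= a)%N -> forall g : {set 'I_n} -> S,
  (forall F F', F \in L -> F' \in L -> A \subset F -> A \subset F' ->
     ~~ (F :&: F' \subset A) -> g F = g F') ->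
  forall F F', F \in L -> F' \in L -> A \subset F -> A \subset F' -> g F = g F'.

Definition vanish_big f := forall F, F \in L -> #|F| != a -> restrict F f = 0.
Definition vanish_all f := forall F, F \in L -> restrict F f = 0.

Variables (M : lmodType S) (cls : S -> M).
Hypothesis clsD : forall f g, vanish_big f -> vanish_big g -> cls (f + g) = cls f + cls g.
Hypothesis clsZ : forall c f, vanish_big f -> cls (c * f) = c *: cls f.
Hypothesis cls_surj : forall m, exists2 f, vanish_big f & m = cls f.
Hypothesis cls_eq : forall f g, vanish_big f -> vanish_big g ->
  (cls f = cls g <-> vanish_all (f - g)).

Lemma vanish_big0 : vanish_big 0.
Proof. by move=> F _ _; rewrite rmorph0. Qed.

Lemma vanish_bigM c f : vanish_big f -> vanish_big (c * f).
Proof. by move=> H F FL Fa; rewrite rmorphM /= H // mulr0. Qed.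

Lemma vanish_bigD f g : vanish_big f -> vanish_big g -> vanish_big (f + g).
Proof. by move=> H H' F FL Fa; rewrite rmorphD /= H // H' // addr0. Qed.

Lemma cls0 : cls 0 = 0.
Proof. by rewrite -[X in cls X](mul0r 0) clsZ ?scale0r //; apply: vanish_big0. Qed.

Lemma cls_eq0 f : vanish_big f -> (cls f = 0 <-> vanish_all f).
Proof.
move=> fJ; have := cls_eq fJ vanish_big0; rewrite cls0 => ->.
by rewrite subr0.
Qed.

Definition unit_vars (q : {pred S}) : {set 'I_n} := [set v | 'X_v \notin q].

Lemma unit_varsN (q : {pred S}) A v : unit_vars q \subset A -> v \notin A -> 'X_v \in q.
Proof. by move=> /subsetP qA vA; apply: contraNT vA => vq; apply: qA; rewrite inE. Qed.

(** This product becomes a unit at [q] and restricts to zero on every [F] that does not contain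
    [unit_vars q]. Multiplying by it discards those facets. *)
Lemma sqfree_unit_vars (q : prime_idealr S) : sqfree k (unit_vars q) \notin q.
Proof.
rewrite /sqfree; elim/big_ind: _ => [|x y xq yq|v]; first by rewrite idealr1.
  by rewrite prime_idealrM negb_or xq.
by rewrite inE.
Qed.

(** Otherwise the product of the variables outside [q] would annihilate [M]. *)
Lemma ann_sub_facet (q : prime_idealr S) :
  (forall c, (forall m : M, c *: m = 0) -> c \in q) ->
  exists F, [/\ F \in L, #|F| = a & unit_vars q \subset F].
Proof.
move=> annq; apply: contrapT => H.
suff /annq : forall m : M, sqfree k (unit_vars q) *: m = 0.
  by rewrite (negbTE (sqfree_unit_vars q)).
move=> m; have [f fJ ->] := cls_surj m.
rewrite -clsZ //; apply/cls_eq0; first exact: vanish_bigM.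
move=> F FL; rewrite rmorphM /= restrict_sqfree.
case: ifP => [qF|_]; last by rewrite mul0r.
case: (eqVneq #|F| a) => Fa; last by rewrite fJ // mulr0.
by case: H; exists F.
Qed.

(** * Regular elements at a prime *)

Section AtPrime.
Variable p : prime_idealr S.
Local Notation A := (unit_vars p).

Lemma var_in_p v : v \notin A -> 'X_v \in p.
Proof. exact: unit_varsN. Qed.

(** After multiplication by [sqfree k A] only the facets containing [A] count, and on each of them
    the functions form a domain. *)
Lemma stratum_regular x :
  (forall F, F \in L -> #|F| = a -> A \subset F -> restrict F x != 0) ->
  loc_regular p M x.
Proof.
move=> xF m; have [f fJ ->] := cls_surj m.
rewrite -clsZ // => /cls_eq0 -/(_ (vanish_bigM _ fJ)) xf0.
exists (sqfree k A); first exact: sqfree_unit_vars.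
rewrite -clsZ //; apply/cls_eq0; first exact: vanish_bigM.
move=> F FL; rewrite rmorphM /= restrict_sqfree.
case: ifP => [AF|_]; last by rewrite mul0r.
case: (eqVneq #|F| a) => Fa; last by rewrite fJ // mulr0.
have /eqP := xf0 F FL; rewrite rmorphM /= mulf_eq0 (negbTE (xF F FL Fa AF)) /=.
by move/eqP ->; rewrite mulr0.
Qed.

(* [t] is a section of the sheaf of functions on the separate facets; the first
   condition says that [y] is regular modulo [x] on each facet, and the second that
   the quotients [restrict F f / restrict F x] agree on the intersections. *)
Lemma stratum_regular2 x y :
  (forall F f g, F \in L -> #|F| = a -> A \subset F ->
     restrict F y * restrict F f = restrict F x * restrict F g ->
     divides (restrict F x) (restrict F f)) ->
  (forall (t : {set 'I_n} -> S) f,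
     (forall F, F \in L -> A \subset F ->
        restrict F (t F) = t F /\ restrict F x * t F = restrict F f) ->
     forall F F', F \in L -> F' \in L -> A \subset F -> A \subset F' ->
       restrict (F :&: F') (t F) = restrict (F :&: F') (t F')) ->
  loc_regular2 p M x y.
Proof.
move=> xyF xglue m m'; have [f fJ ->] := cls_surj m; have [g gJ ->] := cls_surj m'.
rewrite -!clsZ // => /cls_eq -/(_ (vanish_bigM _ fJ) (vanish_bigM _ gJ)) E.
have tex F : exists t, F \in L -> A \subset F ->
    [/\ restrict F t = t, restrict F x * t = restrict F f & #|F| != a -> t = 0].
  case: (boolP (F \in L)) => FL; last by exists 0.
  case: (boolP (A \subset F)) => AF; last by exists 0.
  case: (eqVneq #|F| a) => Fa.
    have [|t ft] := xyF F f g FL Fa AF.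
      by have /eqP := E F FL; rewrite rmorphB !rmorphM /= subr_eq0 => /eqP.
    exists (restrict F t) => _ _; split => //; first by rewrite restrict_id.
    by rewrite -[RHS]restrict_id ft rmorphM /= restrict_id.
  (* On the other members of [L] the function [f] vanishes; the quotient 0 keeps the glued function
     in [vanish_big]. *)
  exists 0 => _ _; split => //; first by rewrite rmorph0.
  by rewrite mulr0 fJ.
have [t tP] := choice tex.
have [||h hE] := @restrict_glue k n (enum [set F in L | A \subset F]) t.
- by move=> F; rewrite mem_enum inE => /andP [FL AF]; case: (tP F FL AF).
- move=> F F'; rewrite !mem_enum !inE => /andP [FL AF] /andP [F'L AF'].
  by apply: (xglue t f) => // F0 F0L AF0; case: (tP F0 F0L AF0).
have hF F : F \in L -> A \subset F -> restrict F h = t F.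
  by move=> FL AF; apply: hE; rewrite mem_enum inE FL.
have hJ : vanish_big (sqfree k A * h).
  move=> F FL Fa; rewrite rmorphM /= restrict_sqfree; case: ifP => AF; last by rewrite mul0r.
  by rewrite hF //; have [_ _ ->] := tP F FL AF; rewrite ?mulr0.
exists (sqfree k A), (cls (sqfree k A * h)); split; first exact: sqfree_unit_vars.
rewrite -!clsZ //; apply/cls_eq; [exact: vanish_bigM|exact: vanish_bigM|].
move=> F FL; rewrite rmorphB !rmorphM /= restrict_sqfree; case: ifP => AF.
  by have [_ <- _] := tP F FL AF; rewrite hF // mulrCA subrr.
by rewrite !mul0r mulr0 subrr.
Qed.

(** Take a minimal [B] containing [A], contained in a facet of size [a] but in none of another size.
    By minimality, at [p], the restrictions to [B] of the functions in [vanish_big] are the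
    multiples of [sqfree k B], and Nakayama's lemma applies to this module with one generator. *)
Lemma stratum_seq_proper (F0 : {set 'I_n}) (s : seq S) :
  F0 \in L -> #|F0| = a -> A \subset F0 -> {subset s <= p} ->
  exists m : locmod p M, ~ in_seqM (map (loc_int p) s) m.
Proof.
move=> F0L F0a AF0.
pose P B := [&& A \subset B, [exists F in L, (#|F| == a) && (B \subset F)] &
                [forall F in L, (#|F| != a) ==> ~~ (B \subset F)]].
have PF0 : P F0.
  apply/and3P; split => //; first by apply/exists_inP; exists F0; rewrite // F0a eqxx /=.
  apply/forall_inP => F FL; apply/implyP; apply: contra => /(L_anti F0L FL) <-.
  by rewrite F0a.
have [B /minsetP [/and3P [AB /exists_inP [F1 F1L /andP [/eqP F1a BF1]] /forall_inP BN] Bmin] _] :=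
  minset_exists PF0.
have Bp v : v \notin B -> 'X_v \in p by apply: unit_varsN.
have KB f : vanish_all f -> restrict B f = 0.
  by move=> fK; apply: (restrict_eq0S BF1); apply: fK.
have divB f : vanish_big f -> divides (sqfree k B) (sqfree k A * restrict B f).
  move=> fJ; apply: sqfree_divides => u /mnm_supp_mulX [u' u'f ->].
  move: u'f; rewrite mcoeff_msupp mcoeff_restrict; case: ifP => [u'B|]; last by rewrite eqxx.
  rewrite -mcoeff_msupp => u'f; rewrite (Bmin (A :|: mnm_supp u')) //.
    apply/and3P; split; first exact: subsetUl.
      apply/exists_inP; exists F1; rewrite // F1a eqxx /= subUset (subset_trans AB BF1).
      exact: subset_trans u'B BF1.
    apply/forall_inP => F FL; apply/implyP => Fa; rewrite subUset negb_and orbC.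
    by move/restrict_eq0: (fJ F FL Fa) => /(_ _ u'f) ->.
  by rewrite subUset AB.
(* Up to the unit [sqfree k A], the polynomial [g] is the coordinate of [f] with respect to the
   generator [sqfree k B]. *)
pose Y (m : M) := exists f g, [/\ vanish_big f, m = cls f, g \in p &
  sqfree k A * restrict B f = sqfree k B * g].
have B0 := sqfree_neq0 k B.
apply: (@loc_seq_proper _ p M Y).
- move=> _ _ [f [g [fJ -> gp E]]] [f' [g' [f'J -> g'p E']]].
  exists (f + f'), (g + g'); split; [exact: vanish_bigD|by rewrite clsD|exact: rpredD|].
  by rewrite rmorphD !mulrDr E E'.
- move=> c _ [f [g [fJ -> gp E]]]; exists (c * f), (restrict B c * g); split.
  + exact: vanish_bigM.
  + by rewrite clsZ.
  + exact: idealMr.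
  + by rewrite rmorphM mulrCA E mulrCA.
- move=> c m cp; have [f fJ ->] := cls_surj m; have [h hE] := divB f fJ.
  exists (c * f), (h * restrict B c); split.
  + exact: vanish_bigM.
  + by rewrite clsZ.
  + by apply: idealMr; rewrite restrict_ideal.
  + by rewrite rmorphM mulrCA hE /= mulrC mulrA.
- move=> c m cp [f' [g [f'J cE gp E]]]; have [f fJ mE] := cls_surj m.
  have [h hE] := divB f fJ; exists f, h; split => //.
  have : restrict B c * h \in p.
    suff <- : g = restrict B c * h by [].
    apply: (mulfI B0); rewrite -E mulrCA -hE mulrCA -rmorphM; congr (_ * _).
    apply/eqP; rewrite -subr_eq0 -rmorphB; apply/eqP; apply: KB.
    by apply/cls_eq => //; [apply: vanish_bigM|rewrite clsZ // -mE].
  by rewrite prime_idealrM restrict_ideal // (negbTE cp).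
have BJ : vanish_big (sqfree k B).
  by move=> F FL Fa; rewrite restrict_sqfree (negbTE (implyP (BN F FL) Fa)).
(* The coordinate of the generator is [sqfree k A], which is not in [p]. *)
exists (cls (sqfree k B)) => -[f [g [fJ E gp E']]].
have fB : restrict B f = sqfree k B.
  apply/esym/eqP; rewrite -subr_eq0 -[X in X - _](_ : restrict B (sqfree k B) = _).
    by rewrite -rmorphB; apply/eqP; apply: KB; apply/cls_eq.
  by rewrite restrict_sqfree subxx.
have := sqfree_unit_vars p; suff -> : sqfree k A = g by rewrite gp.
by apply: (mulfI B0); rewrite -E' fB mulrC.
Qed.

End AtPrime.

(** The dimension hypothesis gives a chain of primes [Q] inside [p]. The forms in the variables
    outside [A] provide as much of the regular sequence as they can, and the chain supplies the
    remaining elements. *)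
Lemma stratum_serre : serre 2 M.
Proof.
move=> p d d2 /dim_ge_loc [Q [Qp annQ Qchain]].
set A := unit_vars p.
have [F0 [F0L F0a QF0]] := ann_sub_facet annQ.
have AQ i : A \subset unit_vars (Q i).
  by apply/subsetP => v; rewrite !inE; apply: contra => /Qp.
have AF0 := subset_trans (AQ 0%N) QF0.
have leAa : (#|A| <= a)%N by rewrite -F0a subset_leq_card.
have proper s := @stratum_seq_proper p F0 s F0L F0a AF0.
have Ap v : v \notin A -> 'X_v \in p by apply: var_in_p.
have linp : lin_form k A \in p by apply: lin_form_in.
have notsub F : #|F| = a -> (#|A| < a)%N -> ~~ (F \subset A).
  by move=> Fa; apply: contraL => /subset_leq_card; rewrite Fa -leqNgt.
have reg_lin : (#|A| < a)%N -> loc_regular p M (lin_form k A).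
  by move=> ltAa; apply: stratum_regular => F FL Fa AF; apply/restrict_lin_form_neq0/notsub.
have AFE F : F \in L -> A \subset F -> #|A| = a -> F = A.
  move=> FL AF Aa; have AE : A = F0 by apply/eqP; rewrite eqEcard AF0 Aa F0a /=.
  by rewrite AE; apply/esym/L_anti => //; rewrite -AE.
(* An element of [Q 1] outside [Q 0] does not vanish on [F0], since [Q 0] contains all variables
   outside [F0]. *)
have Q1 : (0 < d)%N -> exists2 f, f \in Q 1%N & restrict F0 f != 0.
  move=> d0; have [_ [f fQ1 fQ0]] := Qchain 0%N d0; exists f => //.
  apply: contra fQ0 => /eqP f0; rewrite -(restrict_ideal (A := F0)) ?f0 ?idealr0 //.
  by move=> v; apply: unit_varsN.
case: d d2 Qchain Q1 => [|[|[|//]]] _ Qchain Q1.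
- by apply: depth_ge_loc0; apply: proper.
- case: (ltngtP #|A| a) leAa => // [ltAa|Aa] _.
    apply: (depth_ge_loc1 linp); first exact: reg_lin.
    by apply: proper => x; rewrite inE => /eqP ->.
  have [//|f fQ f0] := Q1; have F0A := AFE F0 F0L AF0 Aa.
  have xp : restrict A f \in p by rewrite restrict_ideal //; apply: Qp fQ.
  apply: (depth_ge_loc1 xp); last by apply: proper => x; rewrite inE => /eqP ->.
  rewrite F0A in f0; apply: stratum_regular => F FL _ AF.
  by rewrite (AFE F FL AF Aa) restrict_id.
have in2 x y : x \in p -> y \in p -> {subset [:: x; y] <= p}.
  by move=> xp yp z; rewrite !inE => /orP [] /eqP ->.
have {}Q1 := Q1 isT; have [_ [z zQ2 zQ1]] := Qchain 1%N isT.
have inter F F' : A \subset F -> A \subset F' -> A \subset F :&: F'.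
  by move=> AF AF'; rewrite subsetI AF.
have [ltAa|] := ltnP #|A| a; last first.
  move=> leaA; have Aa : #|A| = a by apply/eqP; rewrite eqn_leq leAa.
  have F0A := AFE F0 F0L AF0 Aa; have [f fQ f0] := Q1.
  have AQ1 v : v \notin A -> 'X_v \in Q 1%N.
    move=> vA; have [sub _] := Qchain 0%N isT; apply: sub.
    by apply: (unit_varsN QF0); rewrite F0A.
  (* The sequence is a prime element [y] of [Q 1] followed by the restriction of [z]; as [z] is
     outside [Q 1], [y] does not divide that restriction. *)
  rewrite F0A in f0; have [y [yP yQ yA]] := prime_elt_in_ideal AQ1 fQ f0.
  have yp : y \in p by apply: Qp yQ.
  have zp : restrict A z \in p by rewrite restrict_ideal //; apply: Qp zQ2.
  have [y0 _ yI] := yP.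
  apply: (depth_ge_loc2 yp zp).
  + by apply: stratum_regular => F FL _ AF; rewrite (AFE F FL AF Aa) yA.
  + apply: stratum_regular2 => [F f' g FL _ /(AFE F FL) -> // | t f' _ F F' FL F'L].
      rewrite restrict_id yA => E.
      have /yI [[c cE]|//] : divides y (restrict A z * restrict A f').
        by exists (restrict A g).
      by move: zQ1; rewrite -(restrict_ideal z AQ1) cE mulrC idealMr.
    by move=> /(AFE F FL) -> // /(AFE F' F'L) -> //.
  + by apply: proper; apply: in2.
have [leAa2|ltaA] := leqP (#|A| + 2) a.
  have powp : pow_form k A \in p by apply: pow_form_in.
  apply: (depth_ge_loc2 linp powp); [exact: reg_lin| |by apply: proper; apply: in2].
  apply: stratum_regular2 => [F f g FL Fa AF|t f tP].
    apply: pow_form_regular; rewrite cardsD (setIidPr AF) Fa.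
    by rewrite -(leq_add2l #|A|) subnKC // -Fa subset_leq_card.
  have glue F F' : F \in L -> F' \in L -> A \subset F -> A \subset F' ->
      ~~ (F :&: F' \subset A) -> restrict (F :&: F') (t F) = restrict (F :&: F') (t F').
    move=> FL F'L AF AF' /restrict_lin_form_neq0 x0.
    have [_ E] := tP F FL AF; have [_ E'] := tP F' F'L AF'.
    apply: (mulfI (x0 k)).
    rewrite -{1}(restrict_sub (lin_form k A) (subsetIl F F')) -rmorphM E.
    rewrite -{1}(restrict_sub (lin_form k A) (subsetIr F F')) -rmorphM E' /=.
    by rewrite !restrict_sub ?subsetIl ?subsetIr.
  move=> F F' FL F'L AF AF'.
  case: (boolP (F :&: F' \subset A)) => [FA|]; last exact: glue.
  have -> : F :&: F' = A by apply/eqP; rewrite eqEsubset FA inter.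
  (* When two facets meet only in [A], the linear form is zero on the intersection and cannot be
     cancelled; the values on [A] are carried along a chain instead. *)
  apply: (L_conn leAa2 (g := fun F => restrict A (t F))) => // F1 F2 F1L F2L AF1 AF2 N.
  have AF12 := inter _ _ AF1 AF2.
  by rewrite -(restrict_sub (t F1) AF12) -(restrict_sub (t F2) AF12) glue.
have Aa : a = #|A|.+1 by apply/eqP; rewrite eqn_leq ltAa andbT -ltnS -addn2.
have FE F : #|F| = a -> A \subset F -> exists2 v, v \notin A & F = v |: A.
  move=> Fa AF; have /eqP/cards1P [v vE] : #|F :\: A| = 1%N.
    by rewrite cardsD (setIidPr AF) Fa Aa subSnn.
  have : v \in F :\: A by rewrite vE set11.
  rewrite inE => /andP [vA vF]; exists v => //; apply/eqP.
  by rewrite eq_sym eqEcard subUset sub1set vF AF cardsU1 vA Fa Aa add1n leqnn.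
(* If all of [p] vanished on [A], then [Q 1] would have to contain ['X_v], because [height_one]
   leaves no room between [Q 0] and [p]. It would then contain every element of [p], in particular
   [z]. *)
have [x xp x0] : exists2 x, x \in p & restrict A x != 0.
  apply: contrapT => H.
  have pA f : f \in p -> restrict A f = 0.
    by move=> fp; apply/eqP; apply: contraT => f0; case: H; exists f.
  have [v vA F0E] := FE F0 F0a AF0.
  have F0Q1 w : w \notin v |: A -> 'X_w \in Q 1%N.
    rewrite -F0E => wF0; have [sub _] := Qchain 0%N isT; apply: sub.
    exact: (unit_varsN QF0).
  have [f fQ f0] := Q1.
  have vQ1 : 'X_v \in Q 1%N.
    apply: contraT => vQ; case/negP: f0; apply/eqP; rewrite F0E.
    by apply: (height_one vA F0Q1 _ vQ fQ) => g /Qp; apply: pA.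
  have AQ1 w : w \notin A -> 'X_w \in Q 1%N.
    move=> wA; case: (eqVneq w v) => [->//|wv]; apply: F0Q1.
    by rewrite in_setU1 negb_or wv.
  by move: zQ1; rewrite -(restrict_ideal z AQ1) pA ?idealr0 //; apply: Qp zQ2.
have xAp : restrict A x \in p by rewrite restrict_ideal.
apply: (depth_ge_loc2 xAp linp); last by apply: proper; apply: in2.
  by apply: stratum_regular => F FL Fa AF; rewrite restrict_supr.
apply: stratum_regular2 => [F f g FL Fa AF|t f tP F F' FL F'L AF AF'].
  have [v vA FvA] := FE F Fa AF; rewrite (restrict_supr _ AF).
  by apply: (var_regular FvA vA) => //; rewrite restrict_id.
have [_ E] := tP F FL AF; have [_ E'] := tP F' F'L AF'.
rewrite restrict_supr // in E; rewrite restrict_supr // in E'.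
(* The intersection contains [A], so [restrict A x] stays nonzero on it and cancels. *)
apply: (mulfI x0).
rewrite -(restrict_supr x (inter F F' AF AF')) -!rmorphM E E' /=.
by rewrite !restrict_sub ?subsetIl ?subsetIr.
Qed.

Lemma stratum_dim_le d : dim_ge M d -> (d <= a)%N.
Proof.
case=> q [annq chain]; have [F [FL <- qF]] := ann_sub_facet (annq 0%N (leq0n d)).
by apply: prime_chain_length chain => v; apply: unit_varsN.
Qed.

(** Removing the vertices of [F] one at a time gives a strict chain of coordinate primes. They
    contain the annihilator because [sqfree k F] has a class in [M] and is nonzero on [F]. *)
Lemma stratum_dim_ge F : F \in L -> #|F| = a -> dim_ge M a.
Proof.
move=> FL Fa; pose B j := [set v in drop j (enum F)].
have vB v j : (v \in B j) = (v \in drop j (enum F)) by rewrite inE.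
have BF j : B j \subset F.
  by apply/subsetP => v; rewrite vB => /mem_drop; rewrite mem_enum.
have BB j : B j.+1 \subset B j.
  by apply/subsetP => v; rewrite !vB -addn1 addnC -drop_drop; apply: mem_drop.
exists (fun j : nat => @vars_ideal k n (B j) : prime_idealr S); split.
  move=> i _ c cM; rewrite vars_idealE; apply/eqP; apply: (restrict_eq0S (BF i)).
  have FJ : vanish_big (sqfree k F).
    move=> F' F'L F'a; rewrite restrict_sqfree ifN //.
    by apply: contra F'a => /(L_anti FL F'L) <-; rewrite Fa.
  have := cM (cls (sqfree k F)); rewrite -clsZ // => /cls_eq0 -/(_ (vanish_bigM _ FJ) F FL) /eqP.
  by rewrite rmorphM /= restrict_sqfree subxx mulf_eq0 (negbTE (sqfree_neq0 k F)) orbF => /eqP.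
move=> i ltia; split.
  by move=> f; rewrite !vars_idealE => /eqP f0; apply/eqP/(restrict_eq0S (BB i)).
have lti : (i < size (enum F))%N by rewrite -cardE Fa.
have [v0 _] : exists v, v \in F by apply/card_gt0P; rewrite Fa; apply: leq_ltn_trans ltia.
have dE := drop_nth v0 lti; set v := nth v0 _ i in dE => H.
have vi : v \in B i by rewrite vB dE mem_head.
have vNi : v \notin B i.+1.
  by rewrite vB; have := drop_uniq i (enum_uniq F); rewrite dE /= => /andP [].
have /H : 'X_v \in @vars_ideal k n (B i.+1) by rewrite vars_idealE restrict_var (negbTE vNi).
by rewrite vars_idealE restrict_var vi (negbTE (var_neq0 k v)).
Qed.

End Stratum.

(** * The filtration by facet dimension *)

Section Filtration.
Variables (k : fieldType) (n : nat).
Local Notation S := {mpoly k[n]}.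
Variable I : submodClosed S^o.
Local Notation Q := (quotmod I).
Variable L : {set {set 'I_n}}.
Implicit Types (F : {set 'I_n}) (s : nat) (f g : S).

Lemma projZ c f : c *: proj I f = proj I (c * f).
Proof. exact: quot_scaleE. Qed.

Lemma projB f g : proj I (f - g) = proj I f - proj I g.
Proof. exact: raddfB. Qed.

Definition vanish s f := forall F, F \in L -> (s <= #|F|)%N -> restrict F f = 0.

Definition filt s : {pred Q} := fun x => `[< exists2 f, vanish s f & x = proj I f >].

Lemma filt_closed s : GRing.subsemimod_closed (filt s).
Proof.
split; first split.
- apply/asboolP; exists 0; last by rewrite [RHS](raddf0 (\pi_(quotmod I)%qT)).
  by move=> F _ _; rewrite rmorph0.
- move=> x y /asboolP [f fs ->] /asboolP [g gs ->]; apply/asboolP; exists (f + g).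
    by move=> F FL sF; rewrite rmorphD /= fs // gs // addr0.
  by rewrite projD.
- move=> c x /asboolP [f fs ->]; apply/asboolP; exists (c * f); last by rewrite projZ.
  by move=> F FL sF; rewrite rmorphM /= fs // mulr0.
Qed.

HB.instance Definition _ s := GRing.isSubmodClosed.Build S Q (filt s) (filt_closed s).

Hypothesis IP : forall f : S, f \in I <-> forall F, F \in L -> restrict F f = 0.

Lemma projE f g : proj I f = proj I g <-> forall F, F \in L -> restrict F f = restrict F g.
Proof.
split=> [/projP /IP H F /H|H].
  by rewrite rmorphB /= => /eqP; rewrite subr_eq0 => /eqP.
by apply/projP/IP => F FL; rewrite rmorphB /= H // subrr.
Qed.

Lemma proj_filt s f : proj I f \in filt s <-> vanish s f.
Proof.
split=> [/asboolP [g gs /projE E] F FL sF|H]; first by rewrite E // gs.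
by apply/asboolP; exists f.
Qed.

Section Subquotient.
Variables a b : nat.
Local Notation M := (subquot (filt a : submodClosed Q) (filt b : submodClosed Q)).
Hypothesis ab : forall F, F \in L -> (b <= #|F|)%N = (a < #|F|)%N.

(** The value 0 for classes outside [filt b] is a default that makes the map total. *)
Definition subquot_cls f : M :=
  if insub (proj I f) is Some x then proj (@submod_in _ _ (filt a) (filt b) : submodClosed _) x
  else 0.

Lemma subquot_clsE f (H : proj I f \in zsub (filt b : submodClosed Q)) :
  subquot_cls f = proj (@submod_in _ _ (filt a) (filt b) : submodClosed _) (Sub (proj I f) H).
Proof. by rewrite /subquot_cls insubT. Qed.

Local Notation La := [set F in L | (a <= #|F|)%N].

Lemma vanish_bigE f : vanish_big La a f <-> vanish b f.
Proof.
split=> H F.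
  move=> FL bF; apply: H; rewrite ?inE ?FL //=; move: bF; rewrite ab //.
    exact: ltnW.
  by move=> aF; rewrite gtn_eqF.
rewrite inE => /andP [FL aF] Fa; apply: H => //.
by rewrite ab // ltn_neqAle aF eq_sym Fa.
Qed.

Lemma vanish_allE f : vanish_all La f <-> vanish a f.
Proof.
split=> H F; first by move=> FL aF; apply: H; rewrite inE FL.
by rewrite inE => /andP [FL aF]; apply: H.
Qed.

Lemma zsubP f : vanish_big La a f -> proj I f \in zsub (filt b : submodClosed Q).
Proof. by move=> /vanish_bigE H; apply/(proj_filt b f). Qed.

Lemma subquot_clsD f g : vanish_big La a f -> vanish_big La a g ->
  subquot_cls (f + g) = subquot_cls f + subquot_cls g.
Proof.
move=> fJ gJ; rewrite (subquot_clsE (zsubP fJ)) (subquot_clsE (zsubP gJ)).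
rewrite (subquot_clsE (zsubP (vanish_bigD fJ gJ))) -projD; congr proj.
by apply: val_inj; rewrite /= projD.
Qed.

Lemma subquot_clsZ c f : vanish_big La a f -> subquot_cls (c * f) = c *: subquot_cls f.
Proof.
move=> fJ; rewrite (subquot_clsE (zsubP fJ)) (subquot_clsE (zsubP (vanish_bigM c fJ))).
rewrite [RHS]quot_scaleE; congr proj.
by apply: val_inj; rewrite /= projZ.
Qed.

Lemma subquot_cls_surj (m : M) : exists2 f, vanish_big La a f & m = subquot_cls f.
Proof.
rewrite -(projK m); case: (repr m) => x xb.
have /asboolP [f fb xE] : x \in filt b by [].
have fJ : vanish_big La a f by apply/vanish_bigE.
exists f => //; rewrite (subquot_clsE (zsubP fJ)); congr proj.
exact: val_inj.
Qed.

Lemma subquot_cls_eq f g : vanish_big La a f -> vanish_big La a g ->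
  (subquot_cls f = subquot_cls g <-> vanish_all La (f - g)).
Proof.
move=> fJ gJ; rewrite (subquot_clsE (zsubP fJ)) (subquot_clsE (zsubP gJ)).
rewrite vanish_allE -proj_filt projB.
by split=> [/projP|H]; last apply/projP.
Qed.

End Subquotient.

Hypothesis L_anti : forall F F', F \in L -> F' \in L -> F \subset F' -> F = F'.
Hypothesis L_conn : forall (A : {set 'I_n}) a, (#|A| + 2 <= a)%N -> forall g : {set 'I_n} -> S,
  (forall F F', F \in L -> F' \in L -> (a <= #|F|)%N -> (a <= #|F'|)%N ->
     A \subset F -> A \subset F' -> ~~ (F :&: F' \subset A) -> g F = g F') ->
  forall F F', F \in L -> F' \in L -> (a <= #|F|)%N -> (a <= #|F'|)%N ->
     A \subset F -> A \subset F' -> g F = g F'.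

Definition facet_sizes : seq nat :=
  [seq s <- iota 0 n.+1 | [exists F in L, #|F| == s]].

(* Past the last facet size this is [n.+1], for which [filt] is the whole module. *)
Definition facet_size i := nth n.+1 facet_sizes i.

Lemma facet_sizes_sorted : sorted ltn facet_sizes.
Proof. by apply: sorted_filter; [apply: ltn_trans|apply: iota_ltn_sorted]. Qed.

Lemma card_ord_leq F : (#|F| <= n)%N.
Proof. by rewrite -[X in (_ <= X)%N](card_ord n) max_card. Qed.

Lemma mem_facet_sizes F : F \in L -> #|F| \in facet_sizes.
Proof.
move=> FL; rewrite mem_filter mem_iota add0n ltnS card_ord_leq !andbT.
by apply/exists_inP; exists F.
Qed.

Lemma facet_sizeP i : (i < size facet_sizes)%N -> exists2 F, F \in L & #|F| = facet_size i.
Proof.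
move=> lti; have := mem_nth n.+1 lti; rewrite mem_filter => /andP [/exists_inP [F FL /eqP FE] _].
by exists F.
Qed.

Lemma facet_size_ltn i j : (i < j)%N -> (j <= size facet_sizes)%N ->
  (facet_size i < facet_size j)%N.
Proof.
move=> ij; rewrite leq_eqVlt => /predU1P [jE|ltj].
  rewrite jE in ij; have [F _ <-] := facet_sizeP ij.
  by rewrite jE /facet_size nth_default // ltnS card_ord_leq.
have /(_ i j) := @sorted_ltn_nth _ ltn ltn_trans n.+1 _ facet_sizes_sorted.
by rewrite !inE => H; apply: (H (ltn_trans ij ltj) ltj ij).
Qed.

Lemma facet_size_succ i F : (i < size facet_sizes)%N -> F \in L ->
  (facet_size i.+1 <= #|F|)%N = (facet_size i < #|F|)%N.
Proof.
move=> lti FL; have Fs := mem_facet_sizes FL.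
have ltj : (index #|F| facet_sizes < size facet_sizes)%N by rewrite index_mem.
have <- : facet_size (index #|F| facet_sizes) = #|F| by rewrite /facet_size nth_index.
have mono j j' : (j <= j')%N -> (j' <= size facet_sizes)%N -> (facet_size j <= facet_size j')%N.
  rewrite leq_eqVlt => /predU1P [->//|lt] le; apply: ltnW; exact: facet_size_ltn.
case: (ltnP i (index #|F| facet_sizes)) => cmp.
  by rewrite facet_size_ltn ?mono // ltnW.
have le := mono _ _ cmp (ltnW lti).
by rewrite [RHS]ltnNge le leqNgt (leq_ltn_trans le) // facet_size_ltn.
Qed.

Variable gr : int -> Q -> Prop.
Hypothesis grX : forall c m, exists d, gr d (proj I (c *: 'X_[m])).

(** Restriction keeps or kills each monomial separately, so every term of a vanishing polynomial
    vanishes. *)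
Lemma filt_graded s : graded_submodule gr (filt s : submodClosed Q).
Proof.
move=> x; rewrite -(projK x); move: (repr x) => f /proj_filt fs.
exists [seq proj I (f@_m *: 'X_[m]) | m <- msupp f]; split.
  rewrite big_map {1}(mpolyE f) -[LHS]/(\pi_(quotmod I)%qT _).
  exact: (raddf_sum (\pi_(quotmod I)%qT)).
move=> _ /mapP [m mf ->]; split; last exact: grX.
apply/proj_filt => F FL sF; rewrite -mul_mpolyC rmorphM /= restrictX.
by move/restrict_eq0: (fs F FL sF) => /(_ m mf) /negbTE ->; rewrite mulr0.
Qed.

Theorem sequentially_serre_filtration : sequentially_serre gr 2.
Proof.
pose N i := filt (facet_size i) : submodClosed Q.
have mono i : (i < size facet_sizes)%N -> {subset N i <= N i.+1}.
  move=> lti x; rewrite -(projK x) => /proj_filt H; apply/proj_filt => F FL.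
  by rewrite facet_size_succ // => /ltnW; apply: H.
exists (size facet_sizes), N; split.
- split=> x; rewrite -(projK x); move: (repr x) => f.
    apply/idP/eqP => [/proj_filt H|f0]; last first.
      by rewrite f0; apply: (@rpred0 _ (N 0%N)).
    rewrite -[RHS](raddf0 (\pi_(quotmod I)%qT)); apply/projE => F FL.
    rewrite rmorph0; apply: H => //.
    have [i lti <-] : exists2 i, (i < size facet_sizes)%N & facet_size i = #|F|.
      have Fs := mem_facet_sizes FL.
      by exists (index #|F| facet_sizes); rewrite ?index_mem // /facet_size nth_index.
    by case: i lti => // i lti; apply/ltnW/facet_size_ltn/ltnW.
  by apply/proj_filt => F FL; rewrite /facet_size nth_default // ltnNge card_ord_leq.
- move=> i lti; split; first exact: mono.
  have [F FL Fa] := facet_sizeP lti => H.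
  (* Inclusions are strict: for a facet [F] of the current size, [sqfree k F] vanishes on all larger
     facets but not on [F]. *)
  have /H /proj_filt /(_ F FL) : proj I (sqfree k F) \in N i.+1.
    apply/proj_filt => F' F'L; rewrite facet_size_succ // -Fa => ltF.
    rewrite restrict_sqfree ifN //; apply: contraTN ltF => /(L_anti FL F'L) ->.
    by rewrite ltnn.
  rewrite Fa restrict_sqfree subxx => /(_ (leqnn _)) /eqP.
  by rewrite (negbTE (sqfree_neq0 k F)).
- by move=> i _; apply: filt_graded.
- move=> i lti; have succ F := @facet_size_succ i F lti.
  apply: (@stratum_serre k n [set F in L | (facet_size i <= #|F|)%N] (facet_size i) _ _ _
    (subquot_cls (facet_size i) (facet_size i.+1))).
  + move=> F F'; rewrite !inE => /andP [FL _] /andP [F'L _]; exact: L_anti.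
  + move=> A leA g H F F'; rewrite !inE => /andP [FL aF] /andP [F'L aF'].
    apply: (L_conn leA) => // F1 F2 F1L F2L aF1 aF2; apply: H; rewrite inE ?F1L ?F2L //.
  + exact: subquot_clsD.
  + exact: subquot_clsZ.
  + exact: subquot_cls_surj.
  + exact: subquot_cls_eq.
- move=> i lti; have succ := @facet_size_succ i^~ (ltnW lti).
  have succ' F := @facet_size_succ i.+1 F lti.
  exists (facet_size i.+1); split.
    have [F FL Fa] := facet_sizeP lti.
    apply: (@stratum_dim_ge k n [set F in L | (facet_size i.+1 <= #|F|)%N] (facet_size i.+1) _ _
      (subquot_cls (facet_size i.+1) (facet_size i.+2)) _ _ F) => //.
    + by move=> F1 F2; rewrite !inE => /andP [F1L _] /andP [F2L _]; apply: L_anti.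
    + exact: subquot_clsZ.
    + exact: subquot_cls_eq.
    + by rewrite inE FL Fa /=.
  move=> /(@stratum_dim_le k n [set F in L | (facet_size i <= #|F|)%N] (facet_size i) _
      (subquot_cls (facet_size i) (facet_size i.+1))) H.
  have : (facet_size i.+1 <= facet_size i)%N.
    apply: H.
    + apply: subquot_clsZ => F FL; exact: (facet_size_succ (ltnW lti)).
    + apply: subquot_cls_surj => F FL; exact: (facet_size_succ (ltnW lti)).
    + apply: subquot_cls_eq => F FL; exact: (facet_size_succ (ltnW lti)).
  by rewrite leqNgt facet_size_ltn // ltnW.
Qed.

End Filtration.

(** * Chains of maximal independent sets *)

Lemma facet_extend (V : finType) (D : complex V) (E : {set V}) :
  E \in D -> exists2 F, facet D F & E \subset F.
Proof.
move=> ED; have [F /maxsetP [FD maxF] EF] := maxset_exists (P := fun E => E \in faces D) ED.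
by exists F => //; split.
Qed.

Section Independent.
Variable H : sgraph.
Implicit Types (x y z v w : H) (A B E F X : {set H}).
Local Notation isfacet := (facet (indep_complex H)).

Lemma independentP A :
  reflect (forall x y, x \in A -> y \in A -> ~~ edge x y) (independent A).
Proof.
apply: (iffP forall_inP) => [h x y xA yA|h x xA]; first by have /forall_inP := h x xA; apply.
by apply/forall_inP => y; apply: h.
Qed.

Lemma independentS A B : A \subset B -> independent B -> independent A.
Proof.
by move=> /subsetP AB /independentP iB; apply/independentP => x y /AB xB /AB; apply: iB.
Qed.

Lemma facet_indep F : isfacet F -> independent F.
Proof. by case; rewrite inE. Qed.

Lemma facet_nbr F v : isfacet F -> v \notin F -> exists2 w, w \in F & edge v w.
Proof.
case; rewrite inE => iF maxF vF; apply: contrapT => N.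
have nv w : w \in F -> ~~ edge v w by move=> wF; apply/negP => vw; apply: N; exists w.
have iv : v |: F \in indep_sets H.
  rewrite inE; apply/independentP => x y; rewrite !inE.
  move=> /predU1P [->|xF] /predU1P [->|yF]; rewrite ?edge_irr //; first exact: nv.
    by rewrite edge_sym nv.
  by move/independentP: iF; apply.
by move: vF; rewrite -(maxF _ iv (subsetUr _ _)) setU11.
Qed.

Lemma indep_extend E : independent E -> exists2 F, isfacet F & E \subset F.
Proof. by move=> iE; apply: facet_extend; rewrite inE. Qed.

Lemma indep_facet F : independent F -> (forall v, v \notin F -> exists2 w, w \in F & edge v w) ->
  isfacet F.
Proof.
move=> iF nF; split=> [|E]; first by rewrite inE.
rewrite inE => /independentP iE /subsetP FE; apply/eqP; rewrite eqEsubset andbC.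
apply/andP; split; apply/subsetP => // v vE; apply: contraT => /nF [w wF vw].
by have := iE v w vE (FE w wF); rewrite vw.
Qed.

Section Connected.
Variables (s : nat) (T : Type) (g : {set H} -> T).
Hypothesis s2 : (2 <= s)%N.
Hypothesis gP : forall F F', isfacet F -> isfacet F' -> (s <= #|F|)%N -> (s <= #|F'|)%N ->
  forall x, x \in F -> x \in F' -> g F = g F'.

(* [F'] extends the set obtained from [F] by trading the neighbours of [z] for [z]. *)
Lemma facet_swap F z : isfacet F -> (s <= #|F|)%N -> (#|nbrs z :&: F| <= 1)%N ->
  exists F', [/\ isfacet F', (s <= #|F'|)%N, z \in F' & g F = g F'].
Proof.
move=> fF sF nz; have [zF|zF] := boolP (z \in F); first by exists F.
have iF := facet_indep fF; pose E := z |: (F :\: nbrs z).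
have iE : independent E.
  apply/independentP => x y; rewrite !inE.
  move=> /predU1P [->|/andP [zx xF]] /predU1P [->|/andP [zy yF]] //; first by rewrite edge_irr.
    by rewrite edge_sym.
  by move/independentP: iF; apply.
have cF : (#|F :\: nbrs z| + 1 >= #|F|)%N.
  by rewrite cardsD setIC; move: nz; lia.
have [F' fF' EF'] := indep_extend iE.
have sF' : (s <= #|F'|)%N.
  apply: leq_trans (subset_leq_card EF'); rewrite cardsU1 !inE (negbTE zF) andbF /=.
  by apply: leq_trans sF _; rewrite addnC.
(* At most one of the at least two vertices of [F] is lost, so a common vertex remains. *)
have [w] : exists w, w \in F :\: nbrs z by apply/card_gt0P; move: s2 sF cF; lia.
move=> wE; exists F'; split => //; first by apply: (subsetP EF'); rewrite setU11.
apply: (gP fF fF' sF sF' (x := w)); first by move: wE; rewrite inE => /andP [].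
by apply: (subsetP EF'); rewrite setU1r.
Qed.

(** The neighbours of [z] are pairwise adjacent, so a facet contains at most one of them; [z] can be
    exchanged into both facets. *)
Lemma connected_simplicial : has_simplicial_vertex H ->
  forall F F', isfacet F -> isfacet F' -> (s <= #|F|)%N -> (s <= #|F'|)%N -> g F = g F'.
Proof.
case=> z zP F F' fF fF' sF sF'.
have nz X : isfacet X -> (#|nbrs z :&: X| <= 1)%N.
  move=> /facet_indep /independentP iX; rewrite leqNgt; apply/negP => /card_gt1P.
  case=> x [y []]; rewrite !inE => /andP [zx xX] /andP [zy yX] xy.
  move/negP: (iX x y xX yX); apply; apply: zP; rewrite // !inE; apply/orP; by right.
have [X [fX sX zX ->]] := facet_swap fF sF (nz F fF).
have [X' [fX' sX' zX' ->]] := facet_swap fF' sF' (nz F' fF').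
exact: gP zX zX'.
Qed.

End Connected.

Lemma order_next (c : seq H) x : uniq c -> x \in c -> order (next c) x = size c.
Proof. by move=> uc xc; apply: (order_cycle (cycle_next uc)). Qed.

Lemma next_neq_prev (c : seq H) x : uniq c -> (3 <= size c)%N -> x \in c ->
  next c x != prev c x.
Proof.
move=> uc sc xc; apply/eqP => np.
have x2 : iter 2 (next c) x = x by rewrite /= np next_prev.
have := @findex_iter _ (next c) x 2; rewrite order_next // => /(_ sc).
by rewrite x2 findex0.
Qed.

(** * Odd cycles with vertices of degree two *)

Section SpecialCycle.
Variables (c : seq H) (t : nat) (A : {set H}).
Hypotheses (t2 : (2 <= t)%N) (cP : chordless_cycle c) (sc : size c = t.*2.+1).
Hypotheses (Ac : {subset A <= c}) (cA : #|A| = t) (iA : independent A).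
Hypothesis dA : forall x, x \in A -> degree x = 2%N.

Let uc : uniq c. Proof. by case: cP => _ /andP []. Qed.
Let next_edge x : x \in c -> edge x (next c x).
Proof. by case: cP => _ /andP [cc _] _; apply: next_cycle. Qed.
Let prev_edge x : x \in c -> edge x (prev c x).
Proof. by case: cP => _ /andP [cc _] _ xc; rewrite edge_sym; apply: prev_cycle. Qed.

Lemma special_nbrs x : x \in A -> nbrs x = [set next c x; prev c x].
Proof.
move=> xA; have xc := Ac xA; apply/esym/eqP; rewrite eqEcard; apply/andP; split.
  apply/subsetP => y; rewrite !inE => /orP [] /eqP ->; [exact: next_edge|exact: prev_edge].
rewrite -/(degree x) dA // cards2 next_neq_prev //.
by rewrite sc; move: t2; lia.
Qed.

(** The part of [X] on the cycle is disjoint from its shift by one step, and the cycle has [2t + 1]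
    vertices. *)
Lemma independent_cycle X : independent X -> (#|X :&: [set x in c]| <= t)%N.
Proof.
move=> /independentP iX; set Y := X :&: _.
have nY : [disjoint Y & next c @: Y].
  apply/pred0P => x /=; apply/negP => /andP [xY /imsetP [y yY xE]].
  move: xY yY; rewrite !inE => /andP [xX xc] /andP [yX yc].
  by have := iX y x yX xX; rewrite xE next_edge.
have sub : Y :|: next c @: Y \subset [set x in c].
  rewrite subUset subsetIr /=; apply/subsetP => _ /imsetP [y yY ->].
  by move: yY; rewrite !inE mem_next => /andP [].
have := subset_leq_card sub; rewrite cardsU (disjoint_setI0 nY) cards0 subn0.
rewrite card_imset; last exact: can_inj (prev_next uc).
have -> : #|[set x in c]| = size c by rewrite cardsE; apply/card_uniqP.
rewrite sc; lia.
Qed.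

(** Replace the part of [X] on the cycle by [A]: it is no larger than [A], and the vertices of [A]
    have no neighbours off the cycle. *)
Lemma special_facet X : isfacet X -> exists F, [/\ isfacet F, (#|X| <= #|F|)%N & A \subset F].
Proof.
move=> fX; have iX := facet_indep fX; pose C := [set x in c].
have iE : independent (A :|: X :\: C).
  have nAX x y : x \in A -> y \notin c -> ~~ edge x y.
    move=> xA yc; apply/negP => xy; have : y \in nbrs x by rewrite inE.
    rewrite special_nbrs // !inE => /orP [] /eqP yE; case/negP: yc; rewrite yE.
      by rewrite mem_next Ac.
    by rewrite mem_prev Ac.
  apply/independentP => x y; rewrite !inE.
  move=> /orP [xA|/andP [xc xX]] /orP [yA|/andP [yc yX]].
  - by move/independentP: iA; apply.
  - exact: nAX.
  - by rewrite edge_sym nAX.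
  - by move/independentP: iX; apply.
have [F fF EF] := indep_extend iE; exists F; split => //.
  apply: leq_trans (subset_leq_card EF); rewrite cardsU.
  have -> : A :&: (X :\: C) = set0.
    apply/setP => x; rewrite !inE; apply/negP => /andP [xA /andP [xc _]].
    by rewrite (Ac xA) in xc.
  rewrite cards0 subn0 cA -(cardsID C X) leq_add2r; exact: independent_cycle.
exact: subset_trans (subsetUl _ _) EF.
Qed.

(* Otherwise [X] contains both neighbours of each element of [A]; then [A] is stable
   under two steps along the cycle, hence under one since the cycle is odd. *)
Lemma special_few_nbrs X : independent X -> exists2 x, x \in A & (#|nbrs x :&: X| <= 1)%N.
Proof.
move=> iX; apply: contrapT => N.
have nX x : x \in A -> nbrs x \subset X.
  move=> xA; apply/setIidPl/eqP; rewrite eqEcard subsetIl -/(degree x) dA //=.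
  by rewrite ltnNge; apply/negP => le1; apply: N; exists x.
pose Y := X :&: [set x in c].
have nxtY x : x \in A -> next c x \in Y.
  move=> xA; rewrite !inE mem_next Ac // andbT; apply: (subsetP (nX x xA)).
  by rewrite inE next_edge ?Ac.
have prvY x : x \in A -> prev c x \in Y.
  move=> xA; rewrite !inE mem_prev Ac // andbT; apply: (subsetP (nX x xA)).
  by rewrite inE prev_edge ?Ac.
have YE : Y = prev c @: A.
  apply/esym/eqP; rewrite eqEcard; apply/andP; split.
    by apply/subsetP => _ /imsetP [x /prvY ? ->].
  rewrite card_imset ?cA; first exact: independent_cycle.
  exact: can_inj (next_prev uc).
have next2 x : x \in A -> next c (next c x) \in A.
  by move=> /nxtY; rewrite YE => /imsetP [y yA ->]; rewrite next_prev.
have [x xA] : exists x, x \in A by apply/card_gt0P; rewrite cA; move: t2; lia.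
have iter2 j : iter j.*2 (next c) x \in A.
  by elim: j => // j IH; rewrite doubleS !iterS next2.
(* The [2t + 2] steps are one full turn and one more step, so [A] contains two adjacent vertices. *)
have := iter2 t.+1; rewrite doubleS iterS -sc -(order_next uc (Ac xA)).
rewrite iter_order; last exact: can_inj (prev_next uc).
move=> nA; have /independentP/(_ x (next c x) xA nA) := iA.
by rewrite next_edge // Ac.
Qed.

End SpecialCycle.

(** Exchange some [x] of [A] into [F]; the result shares [x] with a facet containing all of [A]. Two
    facets of the latter kind always meet. *)
Lemma connected_special_cycle (s : nat) (T : Type) (g : {set H} -> T) : (2 <= s)%N ->
  (forall F F', isfacet F -> isfacet F' -> (s <= #|F|)%N -> (s <= #|F'|)%N ->
     forall x, x \in F -> x \in F' -> g F = g F') ->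
  has_special_odd_cycle H ->
  forall F F', isfacet F -> isfacet F' -> (s <= #|F|)%N -> (s <= #|F'|)%N -> g F = g F'.
Proof.
move=> s2 gP [t [c [A [t2 cP sc [Ac cA] [iA dA]]]]].
have to_A F : isfacet F -> (s <= #|F|)%N ->
    exists X, [/\ isfacet X, (s <= #|X|)%N, A \subset X & g F = g X].
  move=> fF sF.
  have [x xA nx] := special_few_nbrs t2 cP sc Ac cA iA dA (facet_indep fF).
  have [F1 [fF1 sF1 xF1 ->]] := facet_swap s2 gP fF sF nx.
  have [X [fX FX AX]] := special_facet t2 cP sc Ac cA iA dA fF.
  have sX := leq_trans sF FX; exists X; split => //.
  exact: gP xF1 (subsetP AX x xA).
move=> F F' fF fF' sF sF'.
have [X [fX sX AX ->]] := to_A F fF sF; have [X' [fX' sX' AX' ->]] := to_A F' fF' sF'.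
have [x xA] : exists x, x \in A by apply/card_gt0P; rewrite cA; move: t2; lia.
exact: gP (subsetP AX x xA) (subsetP AX' x xA).
Qed.

(** * Induced paths and chordless cycles *)

Section InducedPath.
Variable W : {set H}.

Definition induced_path (l : seq H) : bool :=
  [&& all (fun u => u \in W) l, uniq l, sorted (@edge H) l &
      all (fun u => all (fun v => edge u v ==>
        ((index v l == (index u l).+1) || (index u l == (index v l).+1))) l) l].

Lemma induced_pathP l : induced_path l ->
  [/\ {subset l <= W}, uniq l, sorted (@edge H) l &
      forall u v, u \in l -> v \in l -> edge u v ->
        index v l = (index u l).+1 \/ index u l = (index v l).+1].
Proof.
case/and4P => /allP lW ul pl /allP H1; split => // u v ul' vl uv.
have /allP/(_ v vl) := H1 u ul'; rewrite uv /= => /orP [] /eqP; by [left|right].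
Qed.

Lemma induced_path_cons x y l : induced_path (x :: l) -> y \in W -> edge y x ->
  y \notin x :: l -> {in l, forall z, ~~ edge y z} -> induced_path (y :: x :: l).
Proof.
move=> /induced_pathP [lW ul pl iP] yW yx yl yN.
have yneq v : v \in x :: l -> (y == v) = false.
  by move=> vl; apply/negbTE; apply: contraNneq yl => ->.
apply/and4P; split.
- by apply/allP => v; rewrite inE => /predU1P [->|/lW].
- by rewrite cons_uniq yl.
- by rewrite /= yx.
have iy v : v \in x :: l -> edge y v -> v = x.
  by rewrite inE => /predU1P [//|/yN /negbTE ->].
apply/allP => u; rewrite inE => /predU1P [->|ul']; apply/allP => v;
  rewrite inE => /predU1P [->|vl]; apply/implyP => uv.
- by rewrite edge_irr in uv.
- by rewrite (iy v vl uv) /= !eqxx (negbTE (_ : y != x)) ?yneq ?mem_head.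
- rewrite edge_sym in uv; rewrite (iy u ul' uv) /= !eqxx (negbTE (_ : y != x)) ?orbT //.
  by rewrite yneq ?mem_head.
- have [E|E] := iP u v ul' vl uv; rewrite [index v _]/= [index u _]/= !yneq //; move: E => /= ->;
  by rewrite eqxx ?orbT.
Qed.

Lemma chordless_of_induced_path x y z l1 l2 : induced_path (x :: rcons l1 z ++ l2) ->
  edge y x -> edge y z -> y \notin x :: rcons l1 z ++ l2 ->
  {in l1, forall w, ~~ edge y w} -> chordless_cycle (y :: x :: rcons l1 z).
Proof.
set d := x :: rcons l1 z => ip yx yz yd yN.
have [_ ud pd iP] := induced_pathP ip.
have dsub v : v \in d -> v \in d ++ l2 by rewrite mem_cat => ->.
have yd' : y \notin d by apply: contra yd => /dsub.
have udl : uniq d by move: ud; rewrite -[_ :: _]/(d ++ l2) cat_uniq => /andP [].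
have ucyd : uniq (y :: d) by rewrite cons_uniq yd' udl.
have idx v : v \in d -> index v (d ++ l2) = index v d by move=> vd; rewrite index_cat vd.
have yv v : v \in d -> edge y v -> v = x \/ v = z.
  rewrite /d inE mem_rcons inE => /or3P [/eqP ->|/eqP ->|/yN /negbTE -> //]; by [left|right].
have nx : next (y :: d) y = x by rewrite next_nth mem_head /= eqxx.
have nz : next (y :: d) z = y.
  have zd : z \in d by rewrite /d inE mem_rcons mem_head orbT.
  rewrite next_nth inE zd orbT [index _ _]/=.
  have -> : (y == z) = false by apply: contraNF yd' => /eqP ->.
  rewrite nth_default // /d /= size_rcons.
  have -> : (x == z) = false.
    by apply/negbTE; move: udl; rewrite /d /= mem_rcons inE negb_or => /andP [/andP []].
  rewrite ltnS -cats1 index_cat; move: udl; rewrite /d /= rcons_uniq => /and3P [_ /negbTE -> _].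
  by rewrite /= eqxx addn0.
have nd u v : u \in d -> v \in d -> index v d = (index u d).+1 -> v = next (y :: d) u.
  move=> ud' vd E; rewrite next_nth inE ud' orbT [index _ _]/=.
  have -> : (y == u) = false by apply: contraNF yd' => /eqP ->.
  by rewrite -E nth_index.
split.
- by rewrite /d /= size_rcons.
- rewrite /ucycle ucyd andbT /= yx /= rcons_path last_rcons [edge z y]edge_sym yz andbT.
  by move: pd; rewrite /= cat_path => /andP [].
- move=> u v; rewrite !inE => /predU1P [->|ud'] /predU1P [->|vd]; first by rewrite edge_irr.
  + by case/(yv v vd) => ->; [left|right].
  + by rewrite edge_sym => /(yv u ud') [] ->; [right|left].
  + move=> /(iP u v (dsub u ud') (dsub v vd)); rewrite !idx //.
    by case=> E; [left|right]; apply: nd.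
Qed.

(** A longest induced path cannot be extended at its first vertex, so a further neighbour of this
    vertex has another neighbour on the path; the first such one closes a chordless cycle. *)
Lemma exists_chordless_cycle : W != set0 ->
  (forall x z, x \in W -> exists y, [/\ y \in W, edge x y & y != z]) ->
  exists2 c, chordless_cycle c & {subset c <= W}.
Proof.
case/set0Pn => w0 w0W nbr2.
pose P m := [exists l : m.-tuple H, induced_path l].
have P1 : P 1%N.
  apply/existsP; exists [tuple w0]; apply/and4P; split => //=; first by rewrite w0W.
  by rewrite edge_irr.
have Pmax m : P m -> (m <= #|W|)%N.
  case/existsP => l /induced_pathP [lW ul _ _].
  by rewrite -(size_tuple l) -(card_uniqP ul); apply: subset_leq_card; apply/subsetP.
have exP : exists m, P m by exists 1%N.
case: (ex_maxnP exP Pmax) => m /existsP [l lP] mmax.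
case: l lP => [[|x l] /= sl]; first by have := mmax _ P1; rewrite -(eqP sl).
move=> lP; have [lW ul pl iP] := induced_pathP lP.
(* The neighbour avoids the second vertex of the path; for a one-vertex path the default [x]
   excludes nothing, as there are no loops. *)
have [y [yW xy yh]] := nbr2 x (head x l) (lW x (mem_head _ _)).
have yx : edge y x by rewrite edge_sym.
have yl : y \notin x :: l.
  apply/negP => yl.
  have yx' : y != x by apply: contraTneq xy => ->; rewrite edge_irr.
  have [E|] := iP x y (mem_head _ _) yl xy; last by rewrite /= eqxx.
  have := nth_index x yl; rewrite E /= eqxx /= nth0 => yE.
  by rewrite yE eqxx in yh.
case: (boolP (has (edge y) l)) => [hl|/hasPn nl]; last first.
  have ip := induced_path_cons lP yW yx yl nl.
  have /mmax : P m.+1.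
    have ss : size (y :: x :: l) == m.+1 by rewrite /= eqSS.
    by apply/existsP; exists (Tuple ss).
  by rewrite ltnn.
case: (split_find hl) lP yl lW {ul pl iP yh mmax sl} => z l1 l2 yz hl1 lP yl lW.
exists (y :: x :: rcons l1 z).
  by apply: (chordless_of_induced_path lP) => // w wl1; apply: (hasPn hl1).
move=> w; rewrite inE => /predU1P [->//|wd]; apply: lW.
by move: wd; rewrite !inE mem_cat => /orP [->//|->]; rewrite orbT.
Qed.

End InducedPath.

Lemma bipartite_path (F : {set H}) x p : path (@edge H) x p ->
  {in x :: p &, forall u v, edge u v -> (v \in F) = (u \notin F)} ->
  (last x p \in F) = (x \in F) (+) odd (size p).
Proof.
elim: p x => [|y p IH] x /=; first by rewrite addbF.
case/andP => xy py flip; rewrite IH //.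
  by rewrite (flip x y) ?inE ?eqxx ?orbT // addNb addbN.
by move=> u v uy vy; apply: flip; rewrite inE ?uy ?vy orbT.
Qed.

(** If [F] and [F'] are disjoint and no exchange joins them, each vertex of either has two
    neighbours in the other. Their union then carries a chordless cycle, which is even because it
    alternates between two independent sets. *)
Lemma connected_no_even_cycle (s : nat) (T : Type) (g : {set H} -> T) : (2 <= s)%N ->
  (forall F F', isfacet F -> isfacet F' -> (s <= #|F|)%N -> (s <= #|F'|)%N ->
     forall x, x \in F -> x \in F' -> g F = g F') ->
  no_chordless_even_cycle H ->
  forall F F', isfacet F -> isfacet F' -> (s <= #|F|)%N -> (s <= #|F'|)%N -> g F = g F'.
Proof.
move=> s2 gP noeven F F' fF fF' sF sF'.
have [I0|/set0Pn [x]] := eqVneq (F :&: F') set0; last first.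
  by rewrite inE => /andP [xF xF']; apply: gP xF xF'.
have few X X' v : isfacet X -> isfacet X' -> (s <= #|X|)%N -> (s <= #|X'|)%N ->
    v \in X -> (#|nbrs v :&: X'| <= 1)%N -> g X = g X'.
  move=> fX fX' sX sX' vX nv.
  have [Y [fY sY vY ->]] := facet_swap s2 gP fX' sX' nv.
  exact: gP vX vY.
apply: contrapT => gN.
have big v : v \in F -> (1 < #|nbrs v :&: F'|)%N.
  by move=> vF; rewrite ltnNge; apply/negP => /(few F F' v fF fF' sF sF' vF).
have big' v : v \in F' -> (1 < #|nbrs v :&: F|)%N.
  move=> vF; rewrite ltnNge; apply/negP => /(few F' F v fF' fF sF' sF vF) E.
  exact: gN.
have FN v : v \in F -> v \notin F'.
  by move=> vF; apply/negP => vF'; have := in_set0 v; rewrite -I0 inE vF vF'.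
have pick2 (X : {set H}) x z : (1 < #|nbrs x :&: X|)%N ->
    exists y, [/\ y \in X, edge x y & y != z].
  case/card_gt1P => u [v []]; rewrite !inE => /andP [xu uX] /andP [xv vX] uv.
  have [uz|uz] := eqVneq u z; last by exists u.
  by exists v; split => //; rewrite -uz eq_sym.
have [|x z|c cc cW] := @exists_chordless_cycle (F :|: F').
- apply/set0Pn; have [x xF] : exists x, x \in F by apply/card_gt0P; move: s2 sF; lia.
  by exists x; rewrite inE xF.
- rewrite inE => /orP [/big|/big'] /(pick2 _ _ z) [y [yX xy yz]]; exists y; split => //.
    by rewrite inE yX orbT.
  by rewrite inE yX.
have /independentP iF := facet_indep fF; have /independentP iF' := facet_indep fF'.
have flip u v : u \in c -> v \in c -> edge u v -> (v \in F) = (u \notin F).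
  move=> /cW uW /cW vW uv; move: uW vW; rewrite !inE.
  case: (boolP (u \in F)) => uF /=.
    by move=> _ _; apply/negP => vF; have := iF u v uF vF; rewrite uv.
  move=> uF'; case: (boolP (v \in F)) => //= vF vF'.
  by have := iF' u v uF' vF'; rewrite uv.
have := noeven c cc; case: cc => + /andP [+ _] _.
case: c cW flip => [//|x d] cW flip _ /= pd.
(* The walk returns to its starting point, so its length, the size of the cycle, is even. *)
have := @bipartite_path F x (rcons d x) pd; rewrite last_rcons size_rcons => E.
have {}E : (x \in F) = (x \in F) (+) odd (size d).+1.
  by apply: E => u v; rewrite !inE !mem_rcons !inE !orbA !orbb => uc vc; apply: flip; rewrite inE.
by move: E; case: (x \in F) => /= /esym; case: (odd _).
Qed.

End Independent.

(** * Links and the Stanley-Reisner ideal *)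

Section Link.
Variables (G : sgraph) (A : {set G}).
Local Notation U := (closed_nbrs_set A).
Local Notation H := (delete U).

(** With [link_down], this identifies the facets of [H] with the facets of [G] containing [A], for
    independent [A]. *)
Definition link_up (X : {set H}) : {set G} := A :|: [set val x | x in X].
Definition link_down (F : {set G}) : {set H} := [set x | val x \in F].

Lemma nbrs_setP v : reflect (exists2 a, a \in A & edge a v) (v \in nbrs_set A).
Proof.
apply: (iffP bigcupP) => [[a aA]|[a aA av]]; first by rewrite inE; exists a.
by exists a; rewrite // inE.
Qed.

Lemma link_val_notin (x : H) : val x \notin A.
Proof. by have := valP x; rewrite !inE negb_or => /andP []. Qed.

Lemma link_val_edge (x : H) a : a \in A -> ~~ edge a (val x).
Proof.
move=> aA; have := valP x; rewrite !inE negb_or => /andP [_].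
by apply: contra => ax; apply/nbrs_setP; exists a.
Qed.

Lemma link_mem F v : independent F -> A \subset F -> v \in F -> v \notin A ->
  exists x : H, v = val x.
Proof.
move=> /independentP iF /subsetP AF vF vA.
have vU : v \notin U.
  rewrite inE negb_or vA; apply/negP => /nbrs_setP [a aA av].
  by have := iF a v (AF a aA) vF; rewrite av.
by exists (Sub v vU); rewrite SubK.
Qed.

Lemma mem_link_up (X : {set H}) (x : H) : (val x \in link_up X) = (x \in X).
Proof. by rewrite inE (negbTE (link_val_notin x)) /= mem_imset //; apply: val_inj. Qed.

Lemma card_link_up (X : {set H}) : #|link_up X| = (#|A| + #|X|)%N.
Proof.
rewrite cardsU (_ : _ :&: _ = set0) ?cards0 ?subn0 ?card_imset //; first exact: val_inj.
apply/setP => v; rewrite !inE; apply/negP => /andP [vA /imsetP [x _ vE]].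
by have := link_val_notin x; rewrite -vE vA.
Qed.

Lemma link_up_facet (X : {set H}) : independent A ->
  facet (indep_complex H) X -> facet (indep_complex G) (link_up X).
Proof.
move=> /independentP iA fX; have /independentP iX := facet_indep fX.
apply: indep_facet => [|v].
  apply/independentP => u v; rewrite !inE.
  move=> /orP [uA|/imsetP [x xX ->]] /orP [vA|/imsetP [y yX ->]].
  - exact: iA.
  - exact: link_val_edge.
  - by rewrite edge_sym link_val_edge.
  - exact: (iX x y).
case: (boolP (v \in U)) => [|vU].
  rewrite !inE => /orP [->//|/nbrs_setP [a aA av] _].
  by exists a; rewrite ?inE ?aA // edge_sym.
have -> : v = val (Sub v vU : H) by rewrite SubK.
rewrite mem_link_up => /(facet_nbr fX) [w wX vw].
by exists (val w); rewrite ?mem_link_up.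
Qed.

Lemma link_down_facet (F : {set G}) : A \subset F ->
  facet (indep_complex G) F -> facet (indep_complex H) (link_down F).
Proof.
move=> AF fF; have iF := facet_indep fF; apply: indep_facet => [|x].
  apply/independentP => x y; rewrite !inE => xF yF.
  by have /independentP/(_ _ _ xF yF) := iF.
rewrite inE => /(facet_nbr fF) [w wF xw].
have wA : w \notin A.
  by apply: contraL xw => wA; rewrite edge_sym link_val_edge.
have [y wE] := link_mem iF AF wF wA.
by exists y; [rewrite inE -wE | rewrite /edge /= /delete_edge -wE].
Qed.

Lemma link_upK (F : {set G}) : independent F -> A \subset F -> link_up (link_down F) = F.
Proof.
move=> iF AF; apply/setP => v; rewrite inE.
case: (boolP (v \in A)) => [/(subsetP AF) ->//|vA] /=.
apply/imsetP/idP => [[x]|vF]; first by rewrite inE => xF ->.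
by have [x vE] := link_mem iF AF vF vA; exists x; rewrite // inE -vE.
Qed.

(** Removing [A] from the facets turns the bound [a] into [a - #|A|], which is at least 2, and a
    common vertex in [H] becomes a common vertex outside [A]. *)
Lemma link_connected (a : nat) (T : Type) (g : {set G} -> T) : (#|A| + 2 <= a)%N ->
  [\/ no_chordless_even_cycle H, has_simplicial_vertex H | has_special_odd_cycle H] ->
  (forall F F', facet (indep_complex G) F -> facet (indep_complex G) F' ->
     (a <= #|F|)%N -> (a <= #|F'|)%N -> A \subset F -> A \subset F' ->
     ~~ (F :&: F' \subset A) -> g F = g F') ->
  forall F F', facet (indep_complex G) F -> facet (indep_complex G) F' ->
     (a <= #|F|)%N -> (a <= #|F'|)%N -> A \subset F -> A \subset F' -> g F = g F'.
Proof.
move=> leAa cond gP F F' fF fF' aF aF' AF AF'.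
have iA : independent A := independentS AF (facet_indep fF).
have s2 : (2 <= a - #|A|)%N by lia.
have big (X : {set H}) : (a - #|A| <= #|X|)%N = (a <= #|link_up X|)%N.
  by rewrite card_link_up leq_subLR.
rewrite -(link_upK (facet_indep fF) AF) -(link_upK (facet_indep fF') AF').
have {}gP (X X' : {set H}) : facet (indep_complex H) X -> facet (indep_complex H) X' ->
    (a - #|A| <= #|X|)%N -> (a - #|A| <= #|X'|)%N ->
    forall x, x \in X -> x \in X' -> g (link_up X) = g (link_up X').
  move=> fX fX'; rewrite !big => aX aX' x xX xX'.
  apply: gP; rewrite ?subsetUl //; [exact: link_up_facet|exact: link_up_facet|].
  by apply/subsetPn; exists (val x); rewrite ?link_val_notin // inE !mem_link_up xX.
have down E : facet (indep_complex G) E -> (a <= #|E|)%N -> A \subset E ->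
    facet (indep_complex H) (link_down E) /\ (a - #|A| <= #|link_down E|)%N.
  move=> fE aE AE; split; first exact: link_down_facet.
  by rewrite big link_upK ?(facet_indep fE).
have [fX sX] := down F fF aF AF; have [fX' sX'] := down F' fF' aF' AF'.
by case: cond => cond; [ exact: (connected_no_even_cycle s2 gP cond)
  | exact: (connected_simplicial s2 gP cond) | exact: (connected_special_cycle s2 gP cond)].
Qed.

End Link.

(** * The Stanley-Reisner ideal as an intersection of coordinate primes *)

Section StanleyReisner.
Variables (k : fieldType) (V : finType) (D : complex V).
Local Notation n := #|V|.
Local Notation S := {mpoly k[n]}.
Local Notation rank := (@enum_rank V).

Definition facet_set : {set {set 'I_n}} :=
  [set rank @: (F : {set V}) | F in [set F | `[< facet D F >]]].

Lemma facet_setP X : reflect (exists2 F, facet D F & X = rank @: F) (X \in facet_set).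
Proof.
apply: (iffP imsetP) => -[F]; first by rewrite inE => /asboolP fF ->; exists F.
by move=> fF ->; exists F; rewrite // inE; apply/asboolP.
Qed.

Lemma rank_imset_sub (E F : {set V}) : (rank @: E \subset rank @: F) = (E \subset F).
Proof.
apply/idP/idP => [/subsetP H|]; last exact: imsetS.
apply/subsetP => v vE; have := H _ (imset_f rank vE).
by rewrite mem_imset //; apply: enum_rank_inj.
Qed.

Lemma sq_mon_rank (F : {set V}) : sq_mon k F = sqfree k (rank @: F).
Proof. by rewrite /sqfree big_imset //= => x y _ _; apply: enum_rank_inj. Qed.

(** A non-face lies in no facet, so its monomial vanishes on all of them. Conversely, a monomial of
    [f] whose support is a face would survive on a facet containing it. *)
Lemma SR_idealP (f : S) :
  f \in (@SR_ideal k V D : submodClosed S^o) <-> forall X, X \in facet_set -> restrict X f = 0.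
Proof.
split=> [/asboolP [c ->] X /facet_setP [F [FD _] ->]|H].
  rewrite rmorph_sum; apply: big1 => E ED.
  rewrite rmorphM /= sq_mon_rank restrict_sqfree rank_imset_sub ifN ?mulr0 //.
  by apply: contra ED => /faces_sub; apply.
rewrite (mpolyE f) big_seq; apply: (@rpred_sum _ (@SR_ideal k V D : submodClosed S^o)) => m mf.
have mE : rank @: [set v | rank v \in mnm_supp m] = mnm_supp m.
  apply/setP => i; rewrite -(enum_valK i) mem_imset ?inE //; exact: enum_rank_inj.
have [q qE] : divides (sqfree k (mnm_supp m)) (f@_m *: 'X_[m]).
  apply: sqfree_divides => m'; rewrite mcoeff_msupp mcoeffZ mcoeffX.
  by have [->|_] := eqVneq m m'; [rewrite subxx | rewrite mulr0 eqxx].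
apply/asboolP; set E := [set v | rank v \in mnm_supp m] in mE.
have ED : E \notin faces D.
  apply/negP => /facet_extend [F fF EF].
  have /H /restrict_eq0 /(_ m mf) : rank @: F \in facet_set by apply/facet_setP; exists F.
  by rewrite -mE rank_imset_sub EF.
exists (fun F => if F == E then q else 0).
rewrite (bigD1 E) //= eqxx big1 => [|F /andP [_ /negbTE ->]]; last by rewrite mul0r.
by rewrite addr0 sq_mon_rank mE mulrC.
Qed.

Lemma complex_sequentially_S2 :
  (forall (A : {set V}) a, (#|A| + 2 <= a)%N -> forall g : {set V} -> S,
     (forall F F', facet D F -> facet D F' -> (a <= #|F|)%N -> (a <= #|F'|)%N ->
        A \subset F -> A \subset F' -> ~~ (F :&: F' \subset A) -> g F = g F') ->
     forall F F', facet D F -> facet D F' -> (a <= #|F|)%N -> (a <= #|F'|)%N ->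
        A \subset F -> A \subset F' -> g F = g F') ->
  complex_sequentially_serre k D 2.
Proof.
move=> conn; apply: (sequentially_serre_filtration SR_idealP).
- move=> X X' /facet_setP [F [FD maxF] ->] /facet_setP [F' [F'D _] ->].
  by rewrite rank_imset_sub => /(maxF F' F'D) ->.
- move=> A a leA g gP X X' /facet_setP [F fF ->] /facet_setP [F' fF' ->].
  have AE : rank @: [set v | rank v \in A] = A.
    apply/setP => i; rewrite -(enum_valK i) mem_imset ?inE //; exact: enum_rank_inj.
  have cr (E : {set V}) : #|rank @: E| = #|E| by apply: card_imset; apply: enum_rank_inj.
  rewrite -AE !cr !rank_imset_sub; rewrite -AE cr in leA.
  apply: (conn _ a leA (fun F => g (rank @: F))) => // F1 F2 fF1 fF2 a1 a2 A1 A2 N.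
  apply: gP; rewrite ?cr -1?AE ?rank_imset_sub //.
  + by apply/facet_setP; exists F1.
  + by apply/facet_setP; exists F2.
  rewrite -imsetI; last by move=> x y _ _; apply: enum_rank_inj.
  by rewrite rank_imset_sub.
- move=> c m; exists (Posz (mdeg m)); exists (c *: 'X_[m]); split => //.
  by apply: dhomogZ; rewrite dhomogX.
Qed.

End StanleyReisner.

Theorem theorem4p7 (k : fieldType) (G : sgraph)
  (hG : forall F : {set G},
     F \in faces (indep_complex G) -> ~ facet (indep_complex G) F ->
     [\/ no_chordless_even_cycle (delete (closed_nbrs_set F)),
         has_simplicial_vertex (delete (closed_nbrs_set F)) |
         has_special_odd_cycle (delete (closed_nbrs_set F))]) :
  graph_sequentially_serre k G 2.
Proof.
apply: complex_sequentially_S2 => A a leA g gP F F' fF fF' aF aF' AF AF'.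
apply: (@link_connected G A a _ g leA _ gP F F') => //.
apply: hG; first by rewrite inE; apply: independentS AF (facet_indep fF).
(* The set [A] is not a facet, since [F] contains it and has at least two more vertices. *)
move=> [_ maxA]; have [FD _] := fF.
by move: leA aF; rewrite (maxA F FD AF); lia.
Qed.
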